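(* Let $\{X_t^N\}_{t\ge 0}$ be the $N$-urn branching process with rate functions $\{\lambda_k\}_{k\ge 0}$, $\{\psi_k\}_{k\ge 0}$ described in the context, and suppose that $\{X_0^N(i)\}_{1\le i\le N}$ are independent with $X_0^N(i)$ Poisson distributed with mean $\phi(i/N)$ for all $1\le i\le N$, where $\phi\in C^\infty(\mathbb{T})$. Let $\mu_t^N(f)=\frac1N\sum_{i=1}^N X_t^N(i) f(i/N)$. Then $$\lim_{N\to+\infty}\mu_t^N(f)=\int_{\mathbb{T}}\rho_t(u)f(u)\,du \quad\text{in } L^2$$ for any $t\ge 0$ and $f\in C(\mathbb{T})$, where $\{\rho_t\}_{t\ge 0}$ is the unique solution to the ordinary differential equation $$\frac{d}{dt}\rho_t=\mathcal{P}_2\rho_t,\qquad \rho_0=\phi$$ on $C(\mathbb{T})$ endowed with the supremum norm $\|\cdot\|_\infty$.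
   Context: $\mathbb{T}=(0,1]$ is the one-dimensional torus. For $k\ge 0$, $\lambda_k\in C^\infty(\mathbb{T}^2)$ and $\psi_k\in C^\infty(\mathbb{T})$ are nonnegative functions such that, for some $\varepsilon_0>0$, $\sup_{u,v\in\mathbb{T}}\sum_{k\ge 0}k^{2+\varepsilon_0}\lambda_k(u,v)<+\infty$, $\sup_{u\in\mathbb{T}}\sum_{k\ge 0}k^{2+\varepsilon_0}\psi_k(u)<+\infty$, and $\sum_{k\ge 0}k^{2+\varepsilon_0}\lambda_k\in C^\infty(\mathbb{T}^2)$, $\sum_{k\ge 0}k^{2+\varepsilon_0}\psi_k\in C^\infty(\mathbb{T})$. The function $\phi$ is nonnegative. The $N$-urn branching process ($N\ge 1$): $X_t^N=(X_t^N(1),\dots,X_t^N(N))$ is a continuous-time Markov process on $\{0,1,2,\dots\}^N$, where $X_t^N(i)$ is the number of particles in urn $i$ at time $t$. For $1\le i\ne j\le N$ and $k\ge 0$, each particle in urn $i$ dies and simultaneously gives birth to $k$ new particles in urn $j$ at rate $\frac1N\lambda_k(\frac iN,\frac jN)$. For $1\le i\le N$ and $k\ge 0$, each particle in urn $i$ dies and simultaneously gives birth to $k$ new particles in urn $i$ at rate $\psi_k(\frac iN)$. Equivalently, the generator is $$\mathcal{L}_Nf(x)=\frac1N\sum_{k=0}^{+\infty}\sum_{i=1}^N\sum_{j\ne i}x(i)\lambda_k\left(\tfrac iN,\tfrac jN\right)\left(f(x_k^{(i,j)})-f(x)\right)+\sum_{k=0}^{+\infty}\sum_{i=1}^N x(i)\psi_k\left(\tfrac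 iN\right)\left(f(x^i_{k-1})-f(x)\right),$$ where $x_k^{(i,j)}$ is obtained from $x$ by replacing $x(i)$ by $x(i)-1$ and $x(j)$ by $x(j)+k$, and $x^i_{k}$ is obtained from $x$ by replacing $x(i)$ by $x(i)+k$. $\mathcal{P}_2$ is the bounded linear operator on $C(\mathbb{T})$ given by $$(\mathcal{P}_2f)(u)=f(u)\sum_{k=0}^{+\infty}(k-1)\psi_k(u)+\int_{\mathbb{T}}\sum_{k=0}^{+\infty}k\lambda_k(v,u)f(v)\,dv-f(u)\int_{\mathbb{T}}\sum_{k=0}^{+\infty}\lambda_k(u,v)\,dv.$$ *)

(* Defs.v *)
From HB Require Import structures.
From mathcomp Require Import all_boot all_order all_algebra.
From mathcomp Require Import all_classical all_reals all_analysis.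

Set Implicit Arguments.
Unset Strict Implicit.
Unset Printing Implicit Defensive.

Import Order.TTheory GRing.Theory Num.Theory.
Import numFieldNormedType.Exports.

Local Open Scope classical_set_scope.
Local Open Scope ring_scope.

(* Sum of a real series (used only where the series converges absolutely). *)
Notation "\sum_ ( k '<oo' ) F" := (\big[+%R/0%R]_(0 <= k <oo) F%R) : ring_scope.

Section function_spaces.
Variable R : realType.

(* C^n on a normed space: continuous, and every directional derivative exists
   everywhere and is C^(n-1).  Used with V = R and V = R * R, where this is the
   same as having continuous partial derivatives up to order n. *)
Fixpoint Cn (V : normedModType R) (n : nat) (g : V -> R) : Prop :=
  continuous g /\
  match n with
  | 0 => True
  | m.+1 => forall v : V,
      (forall x, derivable g x v) /\ Cn m (fun x => 'D_v g x)
  end.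

Definition smooth (V : normedModType R) (g : V -> R) : Prop :=
  forall n, Cn n g.

(* Functions on the torus (0, 1] are represented by 1-periodic functions on R,
   and functions on its square by functions on R * R that are 1-periodic in
   each variable. *)
Definition CT (f : R -> R) : Prop := continuous f /\ periodic f 1.

Definition CinfT (f : R -> R) : Prop := smooth f /\ periodic f 1.

Definition CinfT2 (g : R * R -> R) : Prop :=
  [/\ smooth g, periodic g (1, 0) & periodic g (0, 1)].

Definition torus : set R := `]0, 1].

Definition supnorm (f : R -> R) : R := sup [set `|f u| | u in torus].

Definition torus_int (f : R -> R) : R := \int[lebesgue_measure]_(u in torus) f u.

End function_spaces.

Arguments torus {R}.

Section rates.
Variable R : realType.
Variables (lambda : nat -> R * R -> R) (psi : nat -> R -> R).

Definition branching_rates (eps0 : R) : Prop :=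
  [/\ forall k, CinfT2 (lambda k) /\ forall z, 0 <= lambda k z,
      forall k, CinfT (psi k) /\ forall u, 0 <= psi k u,
      (ereal_sup [set (\sum_(k <oo) (k%:R `^ (2 + eps0) * lambda k z)%:E)%E
                 | z in torus `*` torus] < +oo)%E /\
      (ereal_sup [set (\sum_(k <oo) (k%:R `^ (2 + eps0) * psi k u)%:E)%E
                 | u in torus] < +oo)%E,
      CinfT2 (fun z => \sum_(k <oo) (k%:R `^ (2 + eps0) * lambda k z)) &
      CinfT (fun u => \sum_(k <oo) (k%:R `^ (2 + eps0) * psi k u))].

Definition P2 (f : R -> R) (u : R) : R :=
  f u * \sum_(k <oo) ((k%:R - 1) * psi k u)
  + torus_int (fun v => (\sum_(k <oo) (k%:R * lambda k (v, u))) * f v)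
  - f u * torus_int (fun v => \sum_(k <oo) lambda k (u, v)).

(* d/dt rho_t = P2 rho_t on [0, +oo[ and rho_0 = phi, in C(T) with the sup
   norm: the difference quotients converge in supnorm.  The increment h is
   restricted to t + h >= 0, so the derivative at t = 0 is one-sided. *)
Definition ode_solution (phi : R -> R) (rho : R -> R -> R) : Prop :=
  [/\ forall t, 0 <= t -> CT (rho t),
      rho 0 = phi &
      forall t, 0 <= t ->
        supnorm (fun u => h^-1 * (rho (t + h) u - rho t u) - P2 (rho t) u)
          @[h --> within [set h | 0 <= t + h] (0 : R)^'] --> (0 : R)].

End rates.

Section urn_process.
Variable R : realType.

Definition config (N : nat) : Type := {ffun 'I_N -> nat}.

(* The ordinal i stands for urn i + 1. *)
Definition urn_pos (N : nat) (i : 'I_N) : R := i.+1%:R / N%:R.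

(* One particle of urn i is replaced by k particles in urn j.  For i != j this
   is x_k^(i,j); for i = j it is x_(k-1)^i.  The truncated subtraction only
   acts when urn i is empty, in which case the jump has rate 0. *)
Definition branch (N : nat) (x : config N) (i j : 'I_N) (k : nat) : config N :=
  [ffun l => (x l - (l == i) + k * (l == j))%N].

Variables (lambda : nat -> R * R -> R) (psi : nat -> R -> R).

Definition urn_generator (N : nat) (f : config N -> R) (x : config N) : R :=
  N%:R^-1 * \sum_(k <oo) (\sum_(i < N) \sum_(j < N | j != i)
      (x i)%:R * lambda k (urn_pos i, urn_pos j) * (f (branch x i j k) - f x))
  + \sum_(k <oo) (\sum_(i < N)
      (x i)%:R * psi k (urn_pos i) * (f (branch x i i k) - f x)).

Definition transition_function (S : choiceType) (p : R -> S -> S -> R) : Prop :=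
  [/\ forall t x y, 0 <= t -> 0 <= p t x y,
      forall t x, 0 <= t -> (\esum_(y in [set: S]) (p t x y)%:E = 1)%E,
      forall x y, p 0 x y = (x == y)%:R &
      forall s t x y, 0 <= s -> 0 <= t ->
        ((p (s + t) x y)%:E = \esum_(z in [set: S]) (p s x z * p t z y)%:E)%E].

(* The right derivative at 0 of the transition semigroup, applied to indicators
   of single configurations (hence, by linearity, to all finitely supported f),
   is the generator: urn_generator (1_y) x is the (x, y) entry of the Q-matrix. *)
Definition has_generator (N : nat)
    (p : R -> config N -> config N -> R) : Prop :=
  forall x y : config N,
    t^-1 * (p t x y - (x == y)%:R) @[t --> (0 : R)^'+]
      --> urn_generator (fun z => (z == y)%:R) x.

Section process.
Context (d : measure_display) (Omega : measurableType d).
Variable P : probability Omega R.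

Definition past (S : Type) (X : R -> Omega -> S) (s : R) : set (set Omega) :=
  <<s [set X r @^-1` [set z] | r in [set r | 0 <= r <= s] & z in [set: S]] >>.

Definition markov_process (S : choiceType) (X : R -> Omega -> S)
    (p : R -> S -> S -> R) : Prop :=
  forall (s t : R) (x y : S) (A : set Omega), 0 <= s -> 0 <= t -> past X s A ->
    (P (A `&` X s @^-1` [set x] `&` X (s + t)%R @^-1` [set y])
     = P (A `&` X s @^-1` [set x]) * (p t x y)%:E)%E.

Definition urn_branching_process (N : nat) (X : R -> Omega -> config N) : Prop :=
  (forall t x, 0 <= t -> measurable (X t @^-1` [set x])) /\
  exists p, [/\ transition_function p, has_generator p & markov_process X p].

Definition mutually_independent (N : nat) (Y : Omega -> config N) : Prop :=
  forall (J : {set 'I_N}) (B : 'I_N -> set nat),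
    P [set w | forall i, i \in J -> B i (Y w i)]
    = (\prod_(i in J) P [set w | B i (Y w i)])%E.

(* poisson_prob r is the Dirac mass at 0 when r = 0; its nat argument is a
   dummy. *)
Definition independent_poisson (N : nat) (phi : R -> R)
    (Y : Omega -> config N) : Prop :=
  mutually_independent Y /\
  forall (i : 'I_N) (B : set nat),
    P [set w | B (Y w i)] = poisson_prob (phi (urn_pos i)) 0 B.

Definition empirical (N : nat) (X : R -> Omega -> config N) (t : R)
    (f : R -> R) (w : Omega) : R :=
  N%:R^-1 * \sum_(i < N) (X t w i)%:R * f (urn_pos i).

End process.
End urn_process.

(* Main.v *)
Require Import Defs.
From mathcomp Require Import all_boot all_order all_algebra.
From mathcomp Require Import all_classical all_reals all_analysis.
From mathcomp Require Import measurable_realfun.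
From mathcomp Require Import ring lra.

Set Implicit Arguments.
Unset Strict Implicit.
Unset Printing Implicit Defensive.

Import Order.TTheory GRing.Theory Num.Theory.
Import numFieldNormedType.Exports.

Local Open Scope classical_set_scope.
Local Open Scope ring_scope.

(** Why the theorem is true. For a function [f] on the urns and a constant [c],
    the conditional second moment of [lin f (X_t) - c], given the initial
    configuration [x], is controlled by an explicit supersolution of the backward
    equation. If [B] is the matrix of mean rates ([drift]) and
    [g_t = exp(t B) f] ([flow]), then [lin g_t x - c] is annihilated by
    [d/dt - L_N], so applying [d/dt - L_N] to its square leaves minus the carre du
    champ. Since a jump concerns a single particle, this term is at most a constant
    times the number [mass x] of particles, and the offspring rates have a second
    moment that is bounded uniformly in [N]. Hence
    [(lin g_t x - c)^2 + exp(L t) * mass x + (1 + t)] is a strict supersolution for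
    [L] large ([generator_quadratic], [second_moment_bound]).

    The transition function is only known to be honest and to have the right
    derivative at time 0 of each single entry, and the rates are unbounded.
    The comparison principle ([comparison]) rests on exactly this: at the first
    time at which the semigroup applied to a bounded function could cross the
    supersolution, truncating the supersolution at a constant level leaves a
    function that differs from a constant on finitely many configurations only,
    because the number of particles tends to infinity outside finite sets. Its
    increments are then governed by finitely many generator entries and by the
    conservation of probability.

    Averaging over independent Poisson initial numbers ([initial_quadratic]),
    dividing by [N^2] and taking [c] to be [N] times the limit gives
    ([empirical_L2]) that the squared L2 distance is at most
    [(m_N - c / N)^2 + O(1 / N)], where [m_N] is the average over the urns of
    [phi * exp(t B) f]. Expanding the exponential and transposing [B], the
    coefficients of [m_N] are averages of [f] against the iterates on [phi] of the
    transposed matrix ([adjoint]). That matrix is a Riemann sum approximation of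
    [P2] on the grid ([adjoint_consistent]), so each coefficient converges to
    the integral of [f] against an iterate of [P2] on [phi], and since all
    coefficients are dominated by those of one exponential series, [m_N] tends to
    the integral of [f] against [rho_t = exp(t P2) phi] ([discrete_mean_cvg]).

    The operator [P2] preserves continuity because the total and the mean rates are
    continuous, which follows from the continuity of the weighted sums by
    domination ([continuous_has_sum]), and these rates being bounded, so is [P2].
    So [rho] is a power series with
    coefficients of geometric growth, hence differentiable in the sup norm
    ([egf_taylor]), and two solutions agree since their difference is, after [n]
    integrations in time, of size [(3 K t)^n / n!] ([ode_unique]). *)

(** * Convergent real series *)

Section HasSum.
Variable R : realType.
Implicit Types (u v w : nat -> R) (l c : R).

Definition has_sum u l := (fun n => \sum_(0 <= k < n) u k) @ \oo --> l.

Lemma has_sum_lim u l : has_sum u l -> \sum_(k <oo) u k = l.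
Proof. by move=> h; apply/cvg_lim. Qed.

Lemma has_sum_unique u l l' : has_sum u l -> has_sum u l' -> l = l'.
Proof. by move=> /has_sum_lim <- /has_sum_lim <-. Qed.

Lemma eq_has_sum u v l : u =1 v -> has_sum u l -> has_sum v l.
Proof. by move=> /funext ->. Qed.

Lemma eq_sum_oo u v : u =1 v -> \sum_(k <oo) u k = \sum_(k <oo) v k.
Proof. by move=> /funext ->. Qed.

Lemma has_sum0 : has_sum (fun=> 0) 0.
Proof.
rewrite /has_sum; under eq_fun do rewrite big1//; exact: cvg_cst.
Qed.

Lemma has_sumD u v l l' : has_sum u l -> has_sum v l' ->
  has_sum (fun k => u k + v k) (l + l').
Proof.
by move=> hu hv; rewrite /has_sum; under eq_fun do rewrite big_split/=; apply: cvgD.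
Qed.

Lemma has_sumZ (c : R) u l : has_sum u l -> has_sum (fun k => c * u k) (c * l).
Proof.
by move=> hu; rewrite /has_sum; under eq_fun do rewrite -mulr_sumr; apply: cvgMl_tmp.
Qed.

Arguments has_sumZ c {u l}.

Lemma has_sumB u v l l' : has_sum u l -> has_sum v l' ->
  has_sum (fun k => u k - v k) (l - l').
Proof.
move=> hu hv0; have hv := has_sumZ (-1) hv0; rewrite mulN1r in hv.
by apply: eq_has_sum (has_sumD hu hv) => k; rewrite mulN1r.
Qed.

Lemma has_sum_sum (I : Type) (s : seq I) (Q : pred I) (u : I -> nat -> R)
    (l : I -> R) : (forall i, Q i -> has_sum (u i) (l i)) ->
  has_sum (fun k => \sum_(i <- s | Q i) u i k) (\sum_(i <- s | Q i) l i).
Proof.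
move=> h; elim: s => [|i s IH].
  by rewrite big_nil; apply: eq_has_sum has_sum0 => k; rewrite big_nil.
rewrite big_cons; case: ifPn => Qi; last first.
  by apply: eq_has_sum IH => k; rewrite big_cons (negbTE Qi).
by apply: eq_has_sum (has_sumD (h i Qi) IH) => k; rewrite big_cons Qi.
Qed.

Lemma ler_has_sum u v l l' : (forall k, u k <= v k) ->
  has_sum u l -> has_sum v l' -> l <= l'.
Proof.
move=> uv hu hv; rewrite -(has_sum_lim hu) -(has_sum_lim hv).
by apply: lim_series_le uv; [apply: cvgP hu|apply: cvgP hv].
Qed.

Lemma has_sum_dom u v l : (forall k, `|u k| <= v k) -> has_sum v l ->
  has_sum u (\sum_(k <oo) u k).
Proof.
move=> uv hv; suff : cvgn (series u) by [].
apply: normed_cvg; apply: (@series_le_cvg _ _ v) => //.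
- by move=> k; exact: normr_ge0.
- by move=> k; apply: le_trans (uv k).
- exact: cvgP hv.
Qed.

Lemma ler_norm_has_sum u v l l' : (forall k, `|u k| <= v k) ->
  has_sum u l -> has_sum v l' -> `|l| <= l'.
Proof.
move=> uv hu hv; rewrite ler_norml; apply/andP; split; last first.
  by apply: ler_has_sum hu hv => k; exact: le_trans (ler_norm _) (uv k).
rewrite lerNl.
have := ler_has_sum _ (has_sumZ (-1) hu) hv; rewrite mulN1r; apply => k.
by rewrite mulN1r (le_trans (ler_norm _))// normrN.
Qed.

Lemma has_sum_tail u l n : has_sum u l ->
  has_sum (fun k => if (k < n)%N then 0 else u k) (l - \sum_(0 <= k < n) u k).
Proof.
move=> hu.
have hh : has_sum (fun k => if (k < n)%N then u k else 0)
    (\sum_(0 <= k < n) u k).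
  apply: cvg_near_cst; near=> m.
  have nm : (n <= m)%N by near: m; exists n.
  rewrite (big_cat_nat (leq0n n) nm)//= [X in _ + X]big1_seq ?addr0; last first.
    by move=> k /andP[_]; rewrite mem_index_iota => /andP[nk _]; rewrite ltnNge nk.
  rewrite [LHS]big_nat_cond [RHS]big_nat_cond.
  by apply: eq_bigr => k /andP[/andP[_ ->]].
apply: eq_has_sum (has_sumB hu hh) => k.
by case: ifPn => _; rewrite ?subrr ?subr0.
Unshelve. all: by end_near. Qed.

Arguments has_sum_tail {u l} n.

(** The tail beyond [n] is dominated by the tail of the dominating series, so a
    partial sum approximates uniformly in whatever parameters [u] depends on. Every
    exchange of a limit with a series below goes through this bound. *)
Lemma has_sum_head u v l l' n : (forall k, `|u k| <= v k) ->
  has_sum u l -> has_sum v l' ->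
  `|l - \sum_(0 <= k < n) u k| <= l' - \sum_(0 <= k < n) v k.
Proof.
move=> uv hu hv.
have h1 := has_sum_tail n hu; have h2 := has_sum_tail n hv.
refine (ler_norm_has_sum _ h1 h2) => k.
by case: ifPn => // _; rewrite normr0.
Qed.

Arguments has_sum_head {u v l l'} n.

Lemma has_sum_small_tail u l (e : R) : 0 < e -> has_sum u l ->
  exists n, `|l - \sum_(0 <= k < n) u k| < e.
Proof.
by move=> e0 /cvgrPdist_lt/(_ e e0)[n _ h]; exists n; apply: h => /=.
Qed.

Lemma cvg_bigsum (I T : Type) (F : set_system T) (s : seq I) (Q : pred I)
    (f : I -> T -> R) (l : I -> R) : Filter F ->
  (forall i, Q i -> f i x @[x --> F] --> l i) ->
  \sum_(i <- s | Q i) f i x @[x --> F] --> \sum_(i <- s | Q i) l i.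
Proof. by move=> FF h; apply: cvg_big => // z; exact: add_continuous. Qed.

(** Tannery's theorem: outside finitely many terms both sums are bounded by a tail
    of the dominating series. *)
Lemma has_sum_tannery (u : nat -> nat -> R) (l : nat -> R) v sv (su : nat -> R) sl :
  (forall N k, `|u N k| <= v k) -> (forall k, (fun N => u N k) @ \oo --> l k) ->
  has_sum v sv -> (forall N, has_sum (u N) (su N)) -> has_sum l sl ->
  su @ \oo --> sl.
Proof.
move=> uv ul hv hu hl.
have lv k : `|l k| <= v k.
  have h : (fun N => `|u N k|) @ \oo --> `|l k| by apply: cvg_norm.
  rewrite -(cvg_lim _ h)//; apply: limr_le; first exact: cvgP h.
  by near=> N; exact: uv.
apply/cvgrPdist_lt => e e0.
have e3 : 0 < e / 3 by rewrite divr_gt0.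
have [n hn] := has_sum_small_tail e3 hv.
have hcv : (fun N => \sum_(0 <= k < n) u N k) @ \oo --> \sum_(0 <= k < n) l k.
  by apply: cvg_bigsum => k _; exact: ul.
near=> N.
have h1 : `|\sum_(0 <= k < n) l k - \sum_(0 <= k < n) u N k| < e / 3.
  by near: N; exact: (cvgr_dist_lt _ _ hcv _ e3).
have h2 := has_sum_head n lv hl hv.
have h3 := has_sum_head n (uv N) (hu N) hv.
have h4 := le_lt_trans (ler_norm _) hn.
rewrite (_ : sl - su N = (sl - \sum_(0 <= k < n) l k)
  + (\sum_(0 <= k < n) l k - \sum_(0 <= k < n) u N k)
  - (su N - \sum_(0 <= k < n) u N k)); last by ring.
rewrite (le_lt_trans (ler_normB _ _))//.
rewrite (_ : e = e / 3 + e / 3 + e / 3); last by field.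
apply: ltrD; last exact: le_lt_trans h3 h4.
rewrite (le_lt_trans (ler_normD _ _))// ltrD//; exact: le_lt_trans h2 h4.
Unshelve. all: by end_near. Qed.

(** Near a point the tails of the dominating series are differences of continuous
    functions, hence uniformly small, and they dominate the tails of the series. *)
Lemma continuous_has_sum (T : topologicalType) (g G : nat -> T -> R)
    (F f : T -> R) (C : R) :
  (forall k, continuous (g k)) -> (forall k, continuous (G k)) -> continuous F ->
  (forall k z, `|g k z| <= C * G k z) ->
  (forall z, has_sum (G ^~ z) (F z)) -> (forall z, has_sum (g ^~ z) (f z)) ->
  continuous f.
Proof.
move=> cg cG cF gG hF hf z.
apply/cvgrPdist_lt => e e0.
have e4 : 0 < e / 4 by rewrite divr_gt0.
have [n] := has_sum_small_tail e4 (has_sumZ C (hF z)).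
move=> /(le_lt_trans (ler_norm _)) hn.
have cs (a : nat -> T -> R) : (forall k, continuous (a k)) ->
    continuous (fun z => \sum_(0 <= k < n) a k z).
  by move=> ca x; apply: cvg_bigsum => k _; exact: ca.
have c1 : continuous (fun z => C * F z - \sum_(0 <= k < n) C * G k z).
  move=> x; apply: cvgB; first by apply: cvgMl_tmp; exact: cF.
  by apply: (@cs (fun k z => C * G k z)) => k y; apply: cvgMl_tmp; exact: cG.
near=> y.
have h1 : `|\sum_(0 <= k < n) g k z - \sum_(0 <= k < n) g k y| < e / 4.
  by near: y; exact: (cvgr_dist_lt _ _ (cs g cg z) _ e4).
have h2 : C * F y - \sum_(0 <= k < n) C * G k y < e / 4.
  by near: y; exact: (cvgr_lt _ (c1 z) _ hn).
have h3 := has_sum_head n (gG^~ z) (hf z) (has_sumZ C (hF z)).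
have h4 := has_sum_head n (gG^~ y) (hf y) (has_sumZ C (hF y)).
rewrite (_ : f z - f y = (f z - \sum_(0 <= k < n) g k z)
  + (\sum_(0 <= k < n) g k z - \sum_(0 <= k < n) g k y)
  - (f y - \sum_(0 <= k < n) g k y)); last by ring.
rewrite (le_lt_trans (ler_normB _ _))//.
apply: (@lt_trans _ _ (e / 4 + e / 4 + e / 4)); last by lra.
apply: ltrD; last exact: le_lt_trans h4 h2.
rewrite (le_lt_trans (ler_normD _ _))// ltrD//; exact: le_lt_trans h3 hn.
Unshelve. all: by end_near. Qed.

End HasSum.

Arguments has_sumZ {R} c {u l}.
Arguments has_sum_tail {R u l} n.
Arguments has_sum_head {R u v l l'} n.

(** * Consequences of the regularity of the rates *)

Section Periodicity.
Variable R : realType.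

Lemma periodicz (U : zmodType) (V : Type) (f : U -> V) (T : U) :
  (forall u, f (u + T) = f u) -> forall (m : int) u, f (u + T *~ m) = f u.
Proof.
move=> fT; have fn n u : f (u + T *+ n) = f u.
  by elim: n u => [|n IH] u; rewrite ?addr0// mulrSr addrA fT IH.
case=> n u; first exact: fn.
by rewrite NegzE mulrNz -(fn n.+1) subrK.
Qed.

(** [1 - ceil u] is the shift that brings [u] into the half-open interval, whose
    closed end is the right one. *)
Definition torus_repr (u : R) : R := u + 1 *~ (1 - Num.ceil u).

Lemma torus_repr_in u : torus (torus_repr u).
Proof.
rewrite /torus /torus_repr/= in_itv/= intrB.
have := ceil_itv u; rewrite intrB => /andP[h1 h2].
by apply/andP; split; lra.
Qed.

Lemma periodic_torus_repr (f : R -> R) u : periodic f 1 -> f (torus_repr u) = f u.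
Proof. by move=> fT; exact: periodicz. Qed.

Lemma pair_mulrz (a b : R) (m : int) : (a, b) *~ m = (a *~ m, b *~ m).
Proof.
rewrite [LHS]surjective_pairing; congr (_, _).
  exact: (raddfMz fst).
exact: (raddfMz snd).
Qed.

Lemma periodic2_torus_repr (g : R * R -> R) u v :
  periodic g (1, 0) -> periodic g (0, 1) ->
  g (torus_repr u, torus_repr v) = g (u, v).
Proof.
move=> g1 g2; pose i : int := 1 - Num.ceil u; pose j : int := 1 - Num.ceil v.
rewrite (_ : (_, _) = (u, v) + (1, 0) *~ i + (0, 1) *~ j).
  by rewrite (periodicz g2) (periodicz g1).
by rewrite !pair_mulrz !mul0rz; congr (_, _) => /=; rewrite ?addr0.
Qed.

Lemma CT_bounded (f : R -> R) : CT f -> exists M : R, forall u, `|f u| <= M.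
Proof.
move=> [cf pf].
have cK : compact (f @` `[0, 1]).
  by apply: continuous_compact; [exact: continuous_subspaceT|exact: segment_compact].
have [M [_ hM]] := compact_bounded cK.
exists (M + 1) => u; rewrite -(periodic_torus_repr u pf).
apply: (hM (M + 1)); first by rewrite ltrDl.
exists (torus_repr u) => //; have := torus_repr_in u.
by rewrite /torus/= !in_itv/= => /andP[/ltW -> ->].
Qed.

Lemma periodic2_bounded (g : R * R -> R) : continuous g ->
  periodic g (1, 0) -> periodic g (0, 1) -> exists M : R, forall z, `|g z| <= M.
Proof.
move=> cg g1 g2.
have cK : compact (g @` (`[0, 1] `*` `[0, 1])).
  apply: continuous_compact; first exact: continuous_subspaceT.
  by apply: compact_setX; exact: segment_compact.
have [M [_ hM]] := compact_bounded cK.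
exists (M + 1) => -[u v]; rewrite -(periodic2_torus_repr u v g1 g2).
apply: (hM (M + 1)); first by rewrite ltrDl.
exists (torus_repr u, torus_repr v) => //.
have := torus_repr_in u; have := torus_repr_in v.
rewrite /torus/= !in_itv/= => /andP[a1 a2] /andP[b1 b2].
by split => /=; apply/andP; split=> //; exact: ltW.
Qed.

End Periodicity.

Section RegularRates.
Variable R : realType.
Variables (lambda : nat -> R * R -> R) (psi : nat -> R -> R).

(** What the proof uses of the rates: a uniform bound on the second moments of
    the offspring rates, and the continuity of the total and the mean rates. *)
Record regular_rates (K : R) : Prop := RegularRates {
  rates_lambda_ge0 : forall k z, 0 <= lambda k z;
  rates_psi_ge0 : forall k u, 0 <= psi k u;
  rates_lambda_moment : forall z,
    exists2 s, has_sum (fun k => (k%:R + 1) ^+ 2 * lambda k z) s & s <= K;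
  rates_psi_moment : forall u,
    exists2 s, has_sum (fun k => (k%:R + 1) ^+ 2 * psi k u) s & s <= K;
  rates_lambda_continuous : continuous (fun z => \sum_(k <oo) lambda k z);
  rates_lambda_mean_continuous :
    continuous (fun z => \sum_(k <oo) (k%:R * lambda k z));
  rates_psi_mean_continuous :
    continuous (fun u => \sum_(k <oo) ((k%:R - 1) * psi k u));
  rates_lambda_periodic1 : forall k, periodic (lambda k) (1, 0);
  rates_lambda_periodic2 : forall k, periodic (lambda k) (0, 1);
  rates_psi_periodic : forall k, periodic (psi k) 1 }.

(** The summability exponent exceeds 2, so the moment weight is bounded by
    [k `^ (2 + eps0)] for [k >= 1]; the indicator of [k = 0] covers the term
    that this power annihilates. *)
Let weight (eps0 : R) k : R := k%:R `^ (2 + eps0) + (k == 0%N)%:R.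

Let moment_le_weight (eps0 : R) k : 0 < eps0 -> (k%:R + 1) ^+ 2 <= 4 * weight eps0 k.
Proof.
move=> e0; rewrite /weight; case: k => [|k].
  rewrite eqxx powR0; last by rewrite gt_eqF// addr_gt0.
  by rewrite !add0r expr1n; lra.
rewrite addr0.
have h : k.+1%:R ^+ 2 <= k.+1%:R `^ (2 + eps0) :> R.
  rewrite -powR_mulrn ?ler0n//; apply: ler_powR; first by rewrite ler1n.
  by rewrite lerDl ltW.
apply: le_trans (_ : 4 * k.+1%:R ^+ 2 <= _); last by rewrite ler_pM2l.
have : 1 <= k.+1%:R :> R by rewrite ler1n.
move: (k.+1%:R) => x x1; nra.
Qed.

(** The series with weight [weight eps0] has a continuous sum by hypothesis, up to
    the continuous term [k = 0], and it dominates the series of the total and of the mean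
    rates as well as that of the second moments. *)
Lemma branching_regular_rates (eps0 : R) : 0 < eps0 ->
  branching_rates lambda psi eps0 -> exists K, regular_rates K.
Proof.
move=> e0 [hl hp [hsl hsp] [sl pl1 pl2] [sp pp]].
have smooth_cont (V : normedModType R) (g : V -> R) : smooth g -> continuous g.
  by move=> /(_ 0%N)[].
have cl k : continuous (lambda k) by have [[/smooth_cont]] := hl k.
have cp k : continuous (psi k) by have [[/smooth_cont]] := hp k.
have pk1 k : periodic (lambda k) (1, 0) by have [[]] := hl k.
have pk2 k : periodic (lambda k) (0, 1) by have [[]] := hl k.
have ppk k : periodic (psi k) 1 by have [[]] := hp k.
have l0 k z : 0 <= lambda k z by have [] := hl k.
have p0 k z : 0 <= psi k z by have [] := hp k.
pose FL z : R := \sum_(k <oo) (k%:R `^ (2 + eps0) * lambda k z).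
pose FP z : R := \sum_(k <oo) (k%:R `^ (2 + eps0) * psi k z).
have sumL z : has_sum (fun k => k%:R `^ (2 + eps0) * lambda k z) (FL z).
  case: z => u v.
  have h k : lambda k (u, v) = lambda k (torus_repr u, torus_repr v).
    by rewrite periodic2_torus_repr.
  suff : cvgn (series (fun k => k%:R `^ (2 + eps0) * lambda k (u, v))) by [].
  under eq_fun do rewrite h.
  apply: nnseries_is_cvg => [k|]; first by rewrite mulr_ge0// powR_ge0.
  apply: le_lt_trans hsl; apply: ereal_sup_ubound.
  by exists (torus_repr u, torus_repr v) => //; split; exact: torus_repr_in.
have sumP u : has_sum (fun k => k%:R `^ (2 + eps0) * psi k u) (FP u).
  have h k : psi k u = psi k (torus_repr u) by rewrite periodic_torus_repr.
  suff : cvgn (series (fun k => k%:R `^ (2 + eps0) * psi k u)) by [].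
  under eq_fun do rewrite h.
  apply: nnseries_is_cvg => [k|]; first by rewrite mulr_ge0// powR_ge0.
  apply: le_lt_trans hsp; apply: ereal_sup_ubound.
  by exists (torus_repr u) => //; exact: torus_repr_in.
have at0 (x : R) : has_sum (fun k => (k == 0%N)%:R * x) x.
  apply: cvg_near_cst; near=> n.
  have n0 : (0 < n)%N by near: n; exists 1%N.
  rewrite -(prednK n0) big_nat_recl// eqxx mul1r big1 ?addr0// => k _.
  by rewrite mul0r.
have wsum (a : nat -> R) s : has_sum (fun k => k%:R `^ (2 + eps0) * a k) s ->
    has_sum (fun k => weight eps0 k * a k) (s + a 0%N).
  move=> hs; apply: eq_has_sum (has_sumD hs (at0 (a 0%N))) => k.
  rewrite /weight mulrDl; congr (_ + _).
  by case: k => // k; rewrite !mul0r.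
have wsumL z := wsum _ _ (sumL z); have wsumP u := wsum _ _ (sumP u).
have w0 k : 0 <= weight eps0 k by rewrite addr_ge0 ?powR_ge0.
have dom (g : nat -> R) k (a : R) : 0 <= a -> `|g k| <= (k%:R + 1) ^+ 2 ->
    `|g k * a| <= 4 * (weight eps0 k * a).
  move=> a0 gk; rewrite normrM (ger0_norm a0) mulrA ler_wpM2r//.
  exact: le_trans gk (moment_le_weight _ _).
have sqk (k : nat) : 0 <= k%:R :> R by [].
have g0 k : `|1 : R| <= (k%:R + 1) ^+ 2 by rewrite normr1; have := sqk k; nra.
have g1 k : `|k%:R : R| <= (k%:R + 1) ^+ 2.
  by rewrite ger0_norm//; have := sqk k; nra.
have g2 k : `|k%:R - 1 : R| <= (k%:R + 1) ^+ 2.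
  by rewrite ler_norml; have h := sqk k; apply/andP; split; nra.
have g3 k : `|(k%:R + 1) ^+ 2 : R| <= (k%:R + 1) ^+ 2 by rewrite ger0_norm// sqr_ge0.
have contL (g : nat -> R) : (forall k, `|g k| <= (k%:R + 1) ^+ 2) ->
    continuous (fun z => \sum_(k <oo) (g k * lambda k z)).
  move=> hg; apply: (@continuous_has_sum _ _ (fun k z => g k * lambda k z)
    (fun k z => weight eps0 k * lambda k z) (fun z => FL z + lambda 0%N z)
    (fun z => \sum_(k <oo) (g k * lambda k z)) 4).
  - by move=> k z; apply: cvgMl_tmp; exact: cl.
  - by move=> k z; apply: cvgMl_tmp; exact: cl.
  - by move=> z; apply: cvgD; [exact: (smooth_cont _ _ sl)|exact: cl].
  - by move=> k z; exact: dom.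
  - exact: wsumL.
  - move=> z; exact: (has_sum_dom (fun k => dom g k _ (l0 k z) (hg k)) (has_sumZ 4 (wsumL z))).
have contP (g : nat -> R) : (forall k, `|g k| <= (k%:R + 1) ^+ 2) ->
    continuous (fun u => \sum_(k <oo) (g k * psi k u)).
  move=> hg; apply: (@continuous_has_sum _ _ (fun k u => g k * psi k u)
    (fun k u => weight eps0 k * psi k u) (fun u => FP u + psi 0%N u)
    (fun u => \sum_(k <oo) (g k * psi k u)) 4).
  - by move=> k z; apply: cvgMl_tmp; exact: cp.
  - by move=> k z; apply: cvgMl_tmp; exact: cp.
  - by move=> z; apply: cvgD; [exact: (smooth_cont _ _ sp)|exact: cp].
  - by move=> k z; exact: dom.
  - exact: wsumP.
  - move=> z; exact: (has_sum_dom (fun k => dom g k _ (p0 k z) (hg k)) (has_sumZ 4 (wsumP z))).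
have [ML hML] := periodic2_bounded (smooth_cont _ _ sl) pl1 pl2.
have [MP hMP] := CT_bounded (conj (smooth_cont _ _ sp) pp).
have [NL hNL] := periodic2_bounded (cl 0%N) (pk1 0%N) (pk2 0%N).
have [NP hNP] := CT_bounded (conj (cp 0%N) (ppk 0%N)).
exists (4 * (ML + NL + MP + NP)); split => //.
- move=> z; have hs := has_sumZ 4 (wsumL z).
  have hm := has_sum_dom (fun k => dom (fun j => (j%:R + 1) ^+ 2) k _ (l0 k z) (g3 k)) hs.
  exists (\sum_(k <oo) ((k%:R + 1) ^+ 2 * lambda k z)) => //.
  have := ler_norm_has_sum (fun k => dom (fun j => (j%:R + 1) ^+ 2) k _ (l0 k z) (g3 k)) hm hs.
  move=> /(le_trans (ler_norm _))/le_trans; apply.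
  rewrite ler_pM2l//.
  have := le_trans (normr_ge0 _) (hMP 0); have := le_trans (normr_ge0 _) (hNP 0).
  have := le_trans (ler_norm _) (hML z); have := le_trans (ler_norm _) (hNL z).
  rewrite /FL; lra.
- move=> z; have hs := has_sumZ 4 (wsumP z).
  have hm := has_sum_dom (fun k => dom (fun j => (j%:R + 1) ^+ 2) k _ (p0 k z) (g3 k)) hs.
  exists (\sum_(k <oo) ((k%:R + 1) ^+ 2 * psi k z)) => //.
  have := ler_norm_has_sum (fun k => dom (fun j => (j%:R + 1) ^+ 2) k _ (p0 k z) (g3 k)) hm hs.
  move=> /(le_trans (ler_norm _))/le_trans; apply.
  rewrite ler_pM2l//.
  have := le_trans (normr_ge0 _) (hML 0); have := le_trans (normr_ge0 _) (hNL 0).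
  have := le_trans (ler_norm _) (hMP z); have := le_trans (ler_norm _) (hNP z).
  rewrite /FP; lra.
- have := contL (fun=> 1) g0.
  rewrite (_ : (fun z => _) = (fun z => \sum_(k <oo) lambda k z))//.
  apply/funext => z.
  by apply: eq_sum_oo => k; rewrite mul1r.
- exact: (contL (fun k => k%:R)).
- exact: (contP (fun k => k%:R - 1)).
Unshelve. all: by end_near. Qed.

Lemma rates_bound_ge0 (K : R) : regular_rates K -> 0 <= K.
Proof.
move=> reg; have [s hs] := rates_lambda_moment reg (0, 0); apply: le_trans.
apply: (ler_has_sum _ (@has_sum0 R) hs) => k.
by rewrite mulr_ge0 ?sqr_ge0// (rates_lambda_ge0 reg).
Qed.

End RegularRates.

(** * Exponential generating functions *)

Section DerivePointwise.
Variable R : realType.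
Implicit Types (f g : R -> R) (x df dg : R).

Lemma is_derive_funD f g x df dg : is_derive x (1 : R) f df ->
  is_derive x (1 : R) g dg -> is_derive x (1 : R) (fun y => f y + g y) (df + dg).
Proof. by move=> hf hg; exact: is_deriveD. Qed.

Lemma is_derive_funM f g x df dg : is_derive x (1 : R) f df ->
  is_derive x (1 : R) g dg ->
  is_derive x (1 : R) (fun y => f y * g y) (df * g x + f x * dg).
Proof.
move=> hf hg; rewrite addrC [df * _]mulrC.
exact: (@is_deriveM _ _ f g x 1 df dg hf hg).
Qed.

Lemma is_derive_funZ c f x df : is_derive x (1 : R) f df ->
  is_derive x (1 : R) (fun y => c * f y) (c * df).
Proof. by move=> hf; exact: (@is_deriveZ _ _ _ f c x 1 df hf). Qed.

Lemma is_derive_funB f g x df dg : is_derive x (1 : R) f df ->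
  is_derive x (1 : R) g dg -> is_derive x (1 : R) (fun y => f y - g y) (df - dg).
Proof. by move=> hf hg; exact: is_deriveB. Qed.

Lemma is_derive_funsum n (f : 'I_n -> R -> R) x (df : 'I_n -> R) :
  (forall i, is_derive x (1 : R) (f i) (df i)) ->
  is_derive x (1 : R) (fun y => \sum_(i < n) f i y) (\sum_(i < n) df i).
Proof.
move=> hf; have := @is_derive_sum _ _ _ n f x 1 df hf.
by rewrite (_ : \sum_(i < n) f i = fun y => \sum_(i < n) f i y)//;
  apply/funext => y; rewrite fct_sumE.
Qed.

End DerivePointwise.

Section ExpGenFun.
Variable R : realType.
Implicit Types (c : nat -> R) (A K t h : R).

(** The exponential of a bounded linear operator is studied one coordinate at a
    time: with [c n] the coordinate of the [n]-th iterate, [egf c t] is that of the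
    exponential, and shifting [c] amounts to applying the operator. *)
Definition egf c t : R := limn (pseries (fun n => c n / n`!%:R) t).

Lemma has_sum_expR t : has_sum (fun n => n`!%:R^-1 * t ^+ n) (expR t).
Proof.
apply: (@eq_has_sum _ (exp_coeff t)); first by move=> n; rewrite /exp_coeff/= mulrC.
exact: is_cvg_series_exp_coeff.
Qed.

Arguments has_sum_expR : clear implicits.

Section Growth.
Variables (c : nat -> R) (A K : R).
Hypothesis cAK : forall n, `|c n| <= A * K ^+ n.

Let dom t n : `|c n / n`!%:R * t ^+ n| <= A * (n`!%:R^-1 * (K * `|t|) ^+ n).
Proof.
rewrite !normrM normrX normfV normr_nat exprMn -mulrA [leRHS](_ : _ =
  A * K ^+ n * (n`!%:R^-1 * `|t| ^+ n)); last by ring.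
by apply: ler_wpM2r => //; rewrite mulr_ge0 ?exprn_ge0.
Qed.

Lemma egf_has_sum t : has_sum (fun n => c n / n`!%:R * t ^+ n) (egf c t).
Proof. exact: (has_sum_dom (dom t) (has_sumZ A (has_sum_expR _))). Qed.

Lemma egf_bound t : `|egf c t| <= A * expR (K * `|t|).
Proof.
exact: (ler_norm_has_sum (dom t) (@egf_has_sum t) (has_sumZ A (has_sum_expR _))).
Qed.

Lemma egf0 : egf c 0 = c 0%N.
Proof.
apply: (has_sum_unique (@egf_has_sum 0)).
apply: cvg_near_cst; near=> n.
have n0 : (0 < n)%N by near: n; exists 1%N.
rewrite -(prednK n0) big_nat_recl// expr0 mulr1 divr1 big1 ?addr0// => k _.
by rewrite expr0n/= mulr0.
Unshelve. all: by end_near. Qed.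

End Growth.

Lemma shift_growth c A K : (forall n, `|c n| <= A * K ^+ n) ->
  forall n, `|c n.+1| <= A * K * K ^+ n.
Proof. by move=> cAK n; rewrite -mulrA -exprS. Qed.

Lemma egf_is_derive c A K t : (forall n, `|c n| <= A * K ^+ n) ->
  is_derive t (1 : R) (egf c) (egf (fun n => c n.+1) t).
Proof.
move=> cAK.
have cvc c' A' K' z : (forall n, `|c' n| <= A' * K' ^+ n) ->
    cvgn (pseries (fun n => c' n / n`!%:R) z).
  by move=> h; exact: (cvgP _ (@egf_has_sum _ _ _ h z)).
have diffs c' : pseries_diffs (fun n => c' n / n`!%:R) =
    (fun n => c' n.+1 / n`!%:R).
  apply/funext => n; rewrite /pseries_diffs factS natrM invfM mulrCA.
  by rewrite mulVKf// pnatr_eq0.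
have c1 := shift_growth cAK; have c2 := shift_growth c1.
have := @pseries_snd_diffs R (fun n => c n / n`!%:R) (`|t| + 1) t.
have d1 := diffs c; have d2 := diffs (fun n => c n.+1); rewrite /= in d2.
rewrite d1 d2; apply.
- exact: cvc cAK.
- exact: cvc c1.
- exact: cvc c2.
- by rewrite [ltRHS]ger0_norm ?ltrDl// addr_ge0.
Qed.

Lemma derive_bound_lipschitz (f df : R -> R) (B a b : R) :
  (forall x, is_derive x (1 : R) f (df x)) ->
  (forall x, `|x - a| <= `|b - a| -> `|df x| <= B) ->
  `|f b - f a| <= B * `|b - a|.
Proof.
move=> fd.
have fc x : {for x, continuous f}.
  by apply: differentiable_continuous; apply/derivable1_diffP; case: (fd x).
have [ab|/ltW ba] := leP a b => hB.
- have [x xab ->] := MVT_segment ab (fun x _ => fd x) (continuous_subspaceT fc).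
  rewrite normrM ler_wpM2r//; apply: hB.
  move: xab; rewrite in_itv/= => /andP[ax xb].
  by rewrite !ger0_norm ?subr_ge0// lerD2r.
- have [x xab] := MVT_segment ba (fun x _ => fd x) (continuous_subspaceT fc).
  rewrite distrC [`|b - a|]distrC => ->; rewrite normrM ler_wpM2r//; apply: hB.
  move: xab; rewrite in_itv/= => /andP[bx xa].
  by rewrite distrC [`|b - a|]distrC !ger0_norm ?subr_ge0// lerD2l lerN2.
Qed.

(** The remainder is quadratic in [h] with a constant that depends on the
    coefficients only through their growth; with coefficients that depend on a
    point of the torus, this gives differentiability in the sup norm. *)
Lemma egf_taylor c A K t h : 0 <= K -> (forall n, `|c n| <= A * K ^+ n) ->
  `|egf c (t + h) - egf c t - h * egf (fun n => c n.+1) t|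
    <= A * K * K * expR (K * (`|t| + `|h|)) * `|h| ^+ 2.
Proof.
move=> K0 cAK.
have A0 : 0 <= A by have := cAK 0%N; rewrite expr0 mulr1; exact: le_trans.
have c1 := shift_growth cAK; have c2 := shift_growth c1.
set c' := fun n => c n.+1; set E := expR _.
have lip s : `|s - t| <= `|h| -> `|egf c' s - egf c' t| <= A * K * K * E * `|h|.
  move=> st.
  have h1 : `|egf c' s - egf c' t| <= A * K * K * E * `|s - t|.
    apply: (@derive_bound_lipschitz _ (egf (fun n => c' n.+1))).
      by move=> x; exact: egf_is_derive c1.
    move=> x xt; apply: le_trans (egf_bound c2 x) _.
    apply: ler_wpM2l; first by rewrite !mulr_ge0.
    rewrite ler_expR; apply: ler_wpM2l => //.
    rewrite -[x in `|x|](subrK t) addrC (le_trans (ler_normD _ _))//.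
    by rewrite lerD2l (le_trans xt).
  by apply: le_trans h1 _; rewrite ler_wpM2l// !mulr_ge0// expR_ge0.
pose f s := egf c s - s * egf c' t.
have fd s : is_derive s (1 : R) f (egf c' s - egf c' t).
  have d1 := egf_is_derive s cAK.
  have := is_derive_funM (is_derive_id s (1 : R)) (is_derive_cst (egf c' t) s (1 : R)).
  by rewrite mul1r mulr0 addr0; exact: is_derive_funB.
have := @derive_bound_lipschitz f (fun s => egf c' s - egf c' t)
  (A * K * K * E * `|h|) t (t + h) fd.
rewrite [t + h - t]addrC addKr => /(_ lip).
rewrite expr2 mulrA; apply: le_trans; rewrite /f.
by rewrite le_eqVlt; apply/orP; left; apply/eqP; congr `|_|; ring.
Qed.

End ExpGenFun.

Arguments has_sum_expR {R} t.
Arguments egf_has_sum {R c A K} cAK t.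

(** * Integrals of continuous functions over the torus *)

Section TorusIntegral.
Variable R : realType.
Implicit Types (f g h : R -> R) (a b c M : R).

Local Notation mu := (@lebesgue_measure R).
Local Notation int a b f := (\int[mu]_(x in `]a, b]) f x).

Lemma continuous_integrable_oc f a b : continuous f ->
  mu.-integrable `]a, b] (EFin \o f).
Proof.
move=> cf.
have I : mu.-integrable `[a, b] (EFin \o f).
  apply: continuous_compact_integrable; first exact: segment_compact.
  exact: continuous_subspaceT.
apply: integrableS I => //.
by move=> x /=; rewrite !in_itv/= => /andP[/ltW -> ->].
Qed.

Lemma continuous_funD f g : continuous f -> continuous g -> continuous (fun x => f x + g x).
Proof. by move=> cf cg x; apply: cvgD; [exact: cf|exact: cg]. Qed.

Lemma continuous_funB f g : continuous f -> continuous g -> continuous (fun x => f x - g x).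
Proof. by move=> cf cg x; apply: cvgB; [exact: cf|exact: cg]. Qed.

Lemma continuous_funM f g : continuous f -> continuous g -> continuous (fun x => f x * g x).
Proof. by move=> cf cg x; apply: cvgM; [exact: cf|exact: cg]. Qed.

Lemma continuous_funZ c f : continuous f -> continuous (fun x => c * f x).
Proof. by move=> cf x; apply: cvgMl_tmp; exact: cf. Qed.

Lemma continuous_funsum n (f : nat -> R -> R) : (forall k, continuous (f k)) ->
  continuous (fun x => \sum_(0 <= k < n) f k x).
Proof. by move=> cf x; apply: cvg_bigsum => k _; exact: cf. Qed.

Lemma measure_oc a b : a <= b -> mu `]a, b] = (b - a)%:E.
Proof.
move=> ab; rewrite lebesgue_measure_itv/= lte_fin.
by move: ab; rewrite le_eqVlt => /predU1P[->|->//]; rewrite ltxx subrr.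
Qed.

Lemma int_oc_cst a b c : a <= b -> int a b (fun=> c) = (b - a) * c.
Proof.
move=> ab; rewrite Rintegral_cst// mulrC; congr (_ * _).
by rewrite -[RHS]/(fine (b - a)%:E) -(measure_oc ab).
Qed.

Lemma int_oc_bound f a b M : continuous f -> a <= b ->
  (forall x, a < x <= b -> `|f x| <= M) -> `|int a b f| <= (b - a) * M.
Proof.
move=> cf ab fM.
have If := continuous_integrable_oc a b cf.
have cn : continuous (fun x => `|f x|) by move=> x; apply: cvg_norm; exact: cf.
apply: le_trans (le_normr_Rintegral _ If) _ => //.
apply: (@le_trans _ _ (int a b (fun=> M))).
  apply: le_Rintegral => //.
  - exact: (continuous_integrable_oc a b cn).
  - by apply: (@continuous_integrable_oc (fun=> M)) => x; exact: cvg_cst.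
by rewrite int_oc_cst.
Qed.

Lemma continuous_integrable_torus f : continuous f ->
  mu.-integrable torus (EFin \o f).
Proof. exact: continuous_integrable_oc. Qed.

Lemma torus_intD f g : continuous f -> continuous g ->
  torus_int (fun u => f u + g u) = torus_int f + torus_int g.
Proof. by move=> cf cg; apply: RintegralD => //; try exact: continuous_integrable_torus; exact: measurable_itv. Qed.

Lemma torus_intB f g : continuous f -> continuous g ->
  torus_int (fun u => f u - g u) = torus_int f - torus_int g.
Proof. by move=> cf cg; apply: RintegralB => //; try exact: continuous_integrable_torus; exact: measurable_itv. Qed.

Lemma torus_intZ c f : continuous f -> torus_int (fun u => c * f u) = c * torus_int f.
Proof. by move=> cf; apply: RintegralZl => //; try exact: continuous_integrable_torus; exact: measurable_itv. Qed.

Lemma torus_int_sum n (f : nat -> R -> R) : (forall k, continuous (f k)) ->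
  torus_int (fun u => \sum_(0 <= k < n) f k u) = \sum_(0 <= k < n) torus_int (f k).
Proof.
move=> cf; elim: n => [|n IH].
  rewrite big_geq//; have := @torus_intZ 0 (fun=> 0) (fun x => cvg_cst _).
  rewrite !mul0r => h; rewrite -[RHS]h; congr torus_int; apply/funext => u.
  by rewrite big_geq.
rewrite big_nat_recr//= -IH -torus_intD//; last exact: continuous_funsum.
by congr torus_int; apply/funext => u; rewrite big_nat_recr.
Qed.

Lemma torus_int_bound f M : continuous f ->
  (forall u, 0 < u <= 1 -> `|f u| <= M) -> `|torus_int f| <= M.
Proof. by move=> cf /(int_oc_bound cf ler01); rewrite subr0 mul1r. Qed.

(** The remainder of the series is bounded uniformly in [u] by a tail of [v], and
    so is its integral over a set of measure 1. *)
Lemma torus_int_has_sum (g : nat -> R -> R) (G : R -> R) (v : nat -> R) (l : R) :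
  (forall n, continuous (g n)) -> (forall n u, `|g n u| <= v n) -> has_sum v l ->
  (forall u, has_sum (g ^~ u) (G u)) ->
  continuous G /\ has_sum (fun n => torus_int (g n)) (torus_int G).
Proof.
move=> cg gv hv hG.
have cG : continuous G.
  apply: (@continuous_has_sum _ _ g (fun n _ => v n) (fun=> l) G 1) => //.
  - by move=> k x; exact: cvg_cst.
  - by move=> x; exact: cvg_cst.
  - by move=> k u; rewrite mul1r.
split=> //; apply/cvgrPdist_lt => e e0.
move: hv => /[dup] hv /cvgrPdist_lt/(_ e e0); apply: filterS => n hn.
rewrite -torus_int_sum// -torus_intB//; last exact: continuous_funsum.
apply: le_lt_trans hn; apply: torus_int_bound.
  by apply: continuous_funB => //; exact: continuous_funsum.
move=> u _; apply: le_trans (ler_norm _).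
exact: (has_sum_head n (gv^~ u) (hG u) hv).
Qed.

(** Heine's theorem on the square, obtained by covering it with neighborhoods on
    which the oscillation is controlled at half of the radius; the second point is
    allowed to leave the square. *)
Lemma uniform_modulus (H : R * R -> R) (e : R) : continuous H -> 0 < e ->
  exists2 dl, 0 < dl & forall u v u' v', 0 <= u <= 1 -> 0 <= v <= 1 ->
    `|u' - u| < dl -> `|v' - v| < dl -> `|H (u', v') - H (u, v)| < e.
Proof.
move=> cH e0.
have cK : compact (`[0, 1]%classic `*` `[0, 1]%classic : set (R * R)).
  by apply: compact_setX; exact: segment_compact.
have e2 : 0 < e / 2 by rewrite divr_gt0.
pose Q (dl : R) (z : R * R) := forall u' v', `|u' - z.1| < dl -> `|v' - z.2| < dl ->
    `|H (u', v') - H z| < e.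
have : \forall dl \near (0 : R)^'+, (`[0, 1]%classic `*` `[0, 1]%classic) `<=` Q dl.
  apply: ((compact_near_coveringP _).1 cK) => -[u v] _.
  have /cvgrPdist_lt/(_ _ e2) := cH (u, v).
  move=> [[A B] /= [/nbhs_ballP[r1 /= r10 hA] /nbhs_ballP[r2 /= r20 hB]] hAB].
  pose r := Num.min r1 r2; have r0 : 0 < r by rewrite lt_min r10.
  have r2p : 0 < r / 2 by rewrite divr_gt0.
  have close u' v' : `|u - u'| < r -> `|v - v'| < r -> `|H (u, v) - H (u', v')| < e / 2.
    rewrite !lt_min => /andP[h1 _] /andP[_ h2].
    by apply: (hAB (u', v')); split; [exact: hA|exact: hB].
  exists (ball (u, v) (r / 2), [set dl | 0 < dl < r / 2]) => /=.
    split; first by apply: nbhsx_ballx.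
    by near=> dl; apply/andP; split; near: dl; [exact: nbhs_right_gt|exact: nbhs_right_lt].
  move=> [[u1 v1] dl] /= [[/= b1 b2] /andP[_ dlr]] u' v' hu hv.
  have b1' : `|u - u1| < r / 2 by exact: b1.
  have b2' : `|v - v1| < r / 2 by exact: b2.
  have k1 : `|H (u, v) - H (u1, v1)| < e / 2.
    by apply: close; [apply: lt_trans b1' _|apply: lt_trans b2' _]; lra.
  have k2 : `|H (u, v) - H (u', v')| < e / 2.
    apply: close.
      rewrite (_ : u - u' = (u - u1) - (u' - u1)); last by ring.
      rewrite (le_lt_trans (ler_normB _ _))//; lra.
    rewrite (_ : v - v' = (v - v1) - (v' - v1)); last by ring.
    rewrite (le_lt_trans (ler_normB _ _))//; lra.
  rewrite (_ : H (u', v') - H (u1, v1) =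
    (H (u, v) - H (u1, v1)) - (H (u, v) - H (u', v'))); last by ring.
  rewrite (le_lt_trans (ler_normB _ _))//; lra.
move=> [r /= r0 hr]; exists (r / 2); first by rewrite divr_gt0.
have rr : `|0 - r / 2| < r by rewrite sub0r normrN ger0_norm; lra.
have rp : 0 < r / 2 by rewrite divr_gt0.
move=> u v u' v' u01 v01; apply: (hr _ rr rp (u, v)).
by split; rewrite /= in_itv.
Unshelve. all: by end_near. Qed.

Lemma continuous_section2 (H : R * R -> R) u : continuous H -> continuous (fun v => H (u, v)).
Proof.
move=> cH v; apply: (cvg_comp (fun x => (u, x)) H); last exact: cH.
have hid : x @[x --> v] --> v by exact: cvg_id.
exact: (cvg_pair (cvg_cst u) hid).
Qed.

(** The modulus of continuity is the same for all sections [H (u, _)], so the error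
    on each of the [N] cells is at most [e / N], whatever [u]. *)
Lemma riemann_uniform (H : R * R -> R) (e : R) : continuous H -> 0 < e ->
  exists n0 : nat, forall N, (n0 <= N)%N -> (0 < N)%N -> forall u, 0 <= u <= 1 ->
    `|N%:R^-1 * \sum_(j < N) H (u, urn_pos R j) - torus_int (fun v => H (u, v))| <= e.
Proof.
move=> cH e0; have [dl dl0 hdl] := uniform_modulus cH e0.
exists (Num.bound dl^-1) => N Nn N0 u u01.
have Npos : 0 < N%:R :> R by rewrite ltr0n.
have Ndl : N%:R^-1 < dl.
  rewrite invf_plt ?posrE//; apply: lt_le_trans (archi_boundP _) _.
    by rewrite invr_ge0 ltW.
  by rewrite ler_nat.
pose h v := H (u, v); have ch : continuous h by exact: continuous_section2.
suff step n : (n <= N)%N ->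
    `|N%:R^-1 * \sum_(j < n) h (j.+1%:R / N%:R) - int 0 (n%:R / N%:R) h|
    <= n%:R / N%:R * e.
  by have := step N (leqnn N); rewrite mulfV ?gt_eqF// mul1r.
elim: n => [|n IH] nN.
  by rewrite big_ord0 !mul0r set_itvoc0 Rintegral_set0 mulr0 subrr normr0.
pose a : R := n%:R / N%:R; pose b : R := n.+1%:R / N%:R.
have ab : b - a = N%:R^-1 by rewrite /a /b -mulrBl -natrB// subSnn mul1r.
have a0 : 0 <= a by rewrite divr_ge0.
have aleb : a <= b by rewrite -subr_ge0 ab invr_ge0 ltW.
have b1 : b <= 1 by rewrite ler_pdivrMr// mul1r ler_nat.
have split_int : int 0 b h = int 0 a h + int a b h.
  rewrite -Rintegral_setU//.
  - congr Rintegral; apply/seteqP; split => x /=; rewrite !in_itv/=.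
      by move=> /andP[x0 xb]; case: (leP x a) => xa; [left|right]; rewrite ?x0 ?xb ?xa.
    by case=> /andP[h1 h2]; apply/andP; split=> //; [exact: le_trans h2 _|exact: le_lt_trans h1].
  - apply: integrableS (continuous_integrable_oc 0 b ch) => //.
      exact: measurableU.
    move=> x /=; rewrite !in_itv/= => -[] /andP[h1 h2]; apply/andP; split=> //.
      exact: le_trans h2 _.
    exact: le_lt_trans h1.
  - apply/disj_setPS => x /=; rewrite !in_itv/= => -[/andP[_ xa] /andP[ax _]].
    by move: xa; rewrite leNgt ax.
have piece : `|N%:R^-1 * h b - int a b h| <= N%:R^-1 * e.
  have -> : N%:R^-1 * h b = int a b (fun=> h b).
      by rewrite int_oc_cst// ab.
  have cb : continuous ((fun=> h b) : R -> R) by move=> x; exact: cvg_cst.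
  rewrite -RintegralB//; try exact: continuous_integrable_oc.
  rewrite -ab; apply: int_oc_bound => //; first exact: continuous_funB.
  move=> x /andP[ax xb]; rewrite ltW//; apply: hdl => //.
  - by rewrite (le_trans a0 (ltW ax)) (le_trans xb).
  - by rewrite subrr normr0.
  - by rewrite ger0_norm ?subr_ge0//; apply: le_lt_trans Ndl; rewrite -ab lerD2l lerN2 ltW.
rewrite big_ord_recr/= split_int mulrDr.
rewrite (_ : _ - _ = (N%:R^-1 * \sum_(j < n) h (j.+1%:R / N%:R) - int 0 a h)
  + (N%:R^-1 * h b - int a b h)); last by rewrite /b; ring.
rewrite (le_trans (ler_normD _ _))//.
rewrite -/b (_ : b * e = a * e + N%:R^-1 * e); last first.
  by rewrite -mulrDl -ab [a + _]addrC subrK.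
by apply: lerD => //; apply: IH; exact: ltnW.
Qed.

(** Periodicity in the parameter moves the point [u0] into the square, where the
    modulus is available. *)
Lemma continuous_torus_int_param (H : R * R -> R) : continuous H ->
  periodic H (1, 0) -> continuous (fun u => torus_int (fun v => H (u, v))).
Proof.
move=> cH pH u0; apply/cvgrPdist_le => e e0.
have [dl dl0 hdl] := uniform_modulus cH e0.
pose s := 1 *~ (1 - Num.ceil u0) : R.
have shift u v : H (u, v) = H (u + s, v).
  rewrite -(periodicz pH (1 - Num.ceil u0)) pair_mulrz mul0rz.
  by rewrite (_ : (u, v) + _ = (u + s, v + 0))// addr0.
near=> u.
have uu0 : `|u0 - u| < dl by near: u; exact: cvgr_dist_lt.
rewrite -torus_intB; try exact: continuous_section2.
apply: torus_int_bound; first by apply: continuous_funB; exact: continuous_section2.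
move=> v /andP[v0 v1]; rewrite (shift u0 v) (shift u v) distrC ltW//.
have /andP[t0 t1] : 0 < u0 + s <= 1 by have := torus_repr_in u0; rewrite /torus/= in_itv.
apply: hdl; rewrite ?t1 ?(ltW t0) ?(ltW v0) ?v1 ?subrr ?normr0//.
by rewrite opprD addrACA subrr addr0 distrC.
Unshelve. all: by end_near. Qed.

End TorusIntegral.

(** * The limit operator and its exponential *)

Section LimitOperator.
Variables (R : realType) (lambda : nat -> R * R -> R) (psi : nat -> R -> R).
Variable K : R.
Hypothesis reg : regular_rates lambda psi K.
Implicit Types (f g : R -> R) (M : R).

Let K0 : 0 <= K := rates_bound_ge0 reg.

Definition total_rate (z : R * R) : R := \sum_(k <oo) lambda k z.
Definition mean_rate (z : R * R) : R := \sum_(k <oo) (k%:R * lambda k z).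
Definition growth_rate (u : R) : R := \sum_(k <oo) ((k%:R - 1) * psi k u).

Let dom (g : nat -> R) k (a : R) : 0 <= a -> `|g k| <= (k%:R + 1) ^+ 2 ->
  `|g k * a| <= (k%:R + 1) ^+ 2 * a.
Proof. by move=> a0 h; rewrite normrM (ger0_norm a0) ler_wpM2r. Qed.

Let sum_bound (a g : nat -> R) s : (forall k, 0 <= a k) ->
  (forall k, `|g k| <= (k%:R + 1) ^+ 2) ->
  has_sum (fun k => (k%:R + 1) ^+ 2 * a k) s -> s <= K ->
  has_sum (fun k => g k * a k) (\sum_(k <oo) (g k * a k)) /\
  `|\sum_(k <oo) (g k * a k)| <= K.
Proof.
move=> a0 gk hs sK.
have h1 := has_sum_dom (fun k => dom (a0 k) (gk k)) hs.
split=> //; apply: le_trans sK.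
exact: (ler_norm_has_sum (fun k => dom (a0 k) (gk k)) h1 hs).
Qed.

Let nat_le (k : nat) : 0 <= k%:R :> R. Proof. by []. Qed.

Lemma total_rate_spec z :
  has_sum (fun k => lambda k z) (total_rate z) /\ `|total_rate z| <= K.
Proof.
have [s hs sK] := rates_lambda_moment reg z.
have g1 (k : nat) : `|1| <= (k%:R + 1) ^+ 2 :> R.
  by rewrite normr1; have := nat_le k; nra.
have [h1 h2] := sum_bound (fun k => rates_lambda_ge0 reg k z) g1 hs sK.
have e : total_rate z = \sum_(k <oo) (1 * lambda k z).
  by apply: eq_sum_oo => k; rewrite mul1r.
by split; rewrite e//; apply: eq_has_sum h1 => k; rewrite mul1r.
Qed.

Lemma mean_rate_spec z :
  has_sum (fun k => k%:R * lambda k z) (mean_rate z) /\ `|mean_rate z| <= K.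
Proof.
have [s hs sK] := rates_lambda_moment reg z.
apply: (sum_bound (fun k => rates_lambda_ge0 reg k z) _ hs sK (g := fun k => k%:R)).
by move=> k; rewrite ger0_norm//; have := nat_le k; nra.
Qed.

Lemma growth_rate_spec u :
  has_sum (fun k => (k%:R - 1) * psi k u) (growth_rate u) /\ `|growth_rate u| <= K.
Proof.
have [s hs sK] := rates_psi_moment reg u.
apply: (sum_bound (fun k => rates_psi_ge0 reg k u) _ hs sK (g := fun k => k%:R - 1)).
by move=> k; rewrite ler_norml; have h := nat_le k; apply/andP; split; nra.
Qed.

Lemma total_rate_continuous : continuous total_rate.
Proof. exact: (rates_lambda_continuous reg). Qed.

Lemma mean_rate_continuous : continuous mean_rate.
Proof. exact: (rates_lambda_mean_continuous reg). Qed.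

Lemma growth_rate_continuous : continuous growth_rate.
Proof. exact: (rates_psi_mean_continuous reg). Qed.

Lemma total_rate_periodic : periodic total_rate (1, 0).
Proof. by move=> z; apply: eq_sum_oo => k; rewrite (rates_lambda_periodic1 reg). Qed.

Lemma mean_rate_periodic : periodic mean_rate (0, 1).
Proof. by move=> z; apply: eq_sum_oo => k; rewrite (rates_lambda_periodic2 reg). Qed.

Lemma growth_rate_periodic : periodic growth_rate 1.
Proof. by move=> u; apply: eq_sum_oo => k; rewrite (rates_psi_periodic reg). Qed.

Lemma P2E f u : P2 lambda psi f u = f u * growth_rate u
  + torus_int (fun v => mean_rate (v, u) * f v)
  - f u * torus_int (fun v => total_rate (u, v)).
Proof. by []. Qed.

(** The integrand of the second term of [P2], with the parameter first. *)
Definition transport f (z : R * R) : R := mean_rate (z.2, z.1) * f z.2.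

Lemma transport_continuous f : continuous f -> continuous (transport f).
Proof.
move=> cf [a b].
have h1 : x.1 @[x --> ((a, b) : R * R)] --> a by exact: cvg_fst.
have h2 : x.2 @[x --> ((a, b) : R * R)] --> b by exact: cvg_snd.
apply: cvgM; last exact: (cvg_comp _ _ h2 (cf b)).
exact: (cvg_comp _ _ (cvg_pair h2 h1) (@mean_rate_continuous (b, a))).
Qed.

Lemma transport_section_continuous f u : continuous f ->
  continuous (fun v => mean_rate (v, u) * f v).
Proof. by move=> cf; exact: (@continuous_section2 R (transport f) u (transport_continuous cf)). Qed.

Lemma total_section_continuous u : continuous (fun v => total_rate (u, v)).
Proof. exact: (@continuous_section2 R total_rate u total_rate_continuous). Qed.

Lemma P2_CT f : CT f -> CT (P2 lambda psi f).
Proof.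
move=> [cf pf]; split.
- have c1 := continuous_funM cf growth_rate_continuous.
  have c2 : continuous (fun u => torus_int (fun v => transport f (u, v))).
    apply: continuous_torus_int_param; first exact: transport_continuous.
    move=> [u v]; rewrite /transport /=; congr (_ * _); last by rewrite addr0.
    by rewrite -(mean_rate_periodic (v, u)).
  have c3 := continuous_funM cf (continuous_torus_int_param
    total_rate_continuous total_rate_periodic).
  exact: (continuous_funB (continuous_funD c1 c2) c3).
- move=> u; rewrite !P2E pf growth_rate_periodic; congr (_ + _ - _ * _).
    congr torus_int; apply/funext => v; congr (_ * _).
    rewrite -(mean_rate_periodic (v, u)); congr mean_rate.
    by rewrite (_ : (v, u) + (0, 1) = (v + 0, u + 1))// addr0.
  congr torus_int; apply/funext => v.
  rewrite -(total_rate_periodic (u, v)); congr total_rate.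
  by rewrite (_ : (u, v) + (1, 0) = (u + 1, v + 0))// addr0.
Qed.

(** Each of the three terms contributes a factor [K]. *)
Lemma P2_bound f M : continuous f -> (forall u, `|f u| <= M) ->
  forall u, `|P2 lambda psi f u| <= M * (3 * K).
Proof.
move=> cf fM u; rewrite P2E.
have M0 : 0 <= M by exact: le_trans (fM u).
have b1 : `|f u * growth_rate u| <= M * K.
  by rewrite normrM ler_pM//; case: (growth_rate_spec u).
have b2 : `|torus_int (fun v => mean_rate (v, u) * f v)| <= M * K.
  apply: torus_int_bound; first exact: transport_section_continuous.
  by move=> v _; rewrite mulrC normrM ler_pM//; case: (mean_rate_spec (v, u)).
have b3 : `|f u * torus_int (fun v => total_rate (u, v))| <= M * K.
  rewrite normrM ler_pM//; apply: torus_int_bound.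
    exact: total_section_continuous.
  by move=> v _; case: (total_rate_spec (u, v)).
rewrite (le_trans (ler_normB _ _))//.
have := ler_normD (f u * growth_rate u) (torus_int (fun v => mean_rate (v, u) * f v)).
lra.
Qed.

Lemma P2B f g u : continuous f -> continuous g ->
  P2 lambda psi (fun v => f v - g v) u = P2 lambda psi f u - P2 lambda psi g u.
Proof.
move=> cf cg; rewrite !P2E.
have -> : torus_int (fun v => mean_rate (v, u) * (f v - g v)) =
    torus_int (fun v => mean_rate (v, u) * f v) - torus_int (fun v => mean_rate (v, u) * g v).
  rewrite -torus_intB; try exact: transport_section_continuous.
  by congr torus_int; apply/funext => v; rewrite mulrBr.
by ring.
Qed.

Lemma P2Z c f u : continuous f ->
  P2 lambda psi (fun v => c * f v) u = c * P2 lambda psi f u.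
Proof.
move=> cf; rewrite !P2E.
have -> : torus_int (fun v => mean_rate (v, u) * (c * f v)) =
    c * torus_int (fun v => mean_rate (v, u) * f v).
  rewrite -torus_intZ; last exact: transport_section_continuous.
  by congr torus_int; apply/funext => v; rewrite mulrCA.
by ring.
Qed.

(** This makes the power series of the exponential commute with [P2]. *)
Lemma P2_has_sum (a : nat -> R -> R) (G : R -> R) (v : nat -> R) (l : R) u :
  (forall n, continuous (a n)) -> (forall n u, `|a n u| <= v n) -> has_sum v l ->
  (forall u, has_sum (a ^~ u) (G u)) ->
  has_sum (fun n => P2 lambda psi (a n) u) (P2 lambda psi G u).
Proof.
move=> ca av hv hG.
have [_ hint] := @torus_int_has_sum R (fun n w => mean_rate (w, u) * a n w)
  (fun w => mean_rate (w, u) * G w) (fun n => K * v n) (K * l)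
  (fun n => @transport_section_continuous (a n) u (ca n))
  (fun n w => ltac:(by rewrite normrM; apply: ler_pM => //; case: (mean_rate_spec (w, u))))
  (has_sumZ K hv) (fun w => has_sumZ (mean_rate (w, u)) (hG w)).
have h1 := has_sumZ (growth_rate u) (hG u).
have h2 := has_sumZ (torus_int (fun v => total_rate (u, v))) (hG u).
rewrite P2E [G u * growth_rate u]mulrC [G u * _]mulrC.
apply: eq_has_sum (has_sumB (has_sumD h1 hint) h2) => n.
by rewrite P2E [a n u * growth_rate u]mulrC [a n u * _]mulrC.
Qed.

Section Solution.
Variable phi : R -> R.
Hypothesis phiCT : CT phi.

Definition P2_iter n : R -> R := iter n (P2 lambda psi) phi.

(** The exponential [exp(t P2) phi], summed pointwise. *)
Definition rho (t u : R) : R := egf (fun n => P2_iter n u) t.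

Lemma P2_iter_CT n : CT (P2_iter n).
Proof. by elim: n => // n IH; exact: P2_CT. Qed.

Variable M : R.
Hypothesis phiM : forall u, `|phi u| <= M.

Lemma P2_iter_bound n u : `|P2_iter n u| <= M * (3 * K) ^+ n.
Proof.
elim: n u => [|n IH] u; first by rewrite mulr1.
by rewrite exprSr mulrA; apply: P2_bound => //; case: (P2_iter_CT n).
Qed.

Let growth u : forall n, `|P2_iter n u| <= M * (3 * K) ^+ n.
Proof. by move=> n; exact: P2_iter_bound. Qed.

Let K30 : 0 <= 3 * K. Proof. by rewrite mulr_ge0. Qed.

Let term t n (u : R) := t ^+ n / n`!%:R * P2_iter n u.

Let term_cont t n : continuous (term t n).
Proof. by apply: continuous_funZ; case: (P2_iter_CT n). Qed.

Let term_bound t n u :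
  `|term t n u| <= M * (n`!%:R^-1 * (3 * K * `|t|) ^+ n).
Proof.
rewrite /term normrM normrM normrX normfV normr_nat.
rewrite (_ : M * _ = `|t| ^+ n / n`!%:R * (M * (3 * K) ^+ n)); last first.
  by rewrite exprMn; ring.
by rewrite ler_wpM2l// divr_ge0// exprn_ge0.
Qed.

Let term_sum t u : has_sum (term t ^~ u) (rho t u).
Proof.
by apply: eq_has_sum (egf_has_sum (growth u) t) => n; rewrite /term; ring.
Qed.

Lemma rho_has_sum_int f t : continuous f -> (exists A : R, forall u, `|f u| <= A) ->
  has_sum (fun n => torus_int (fun u => P2_iter n u * f u) / n`!%:R * t ^+ n)
    (torus_int (fun u => rho t u * f u)).
Proof.
move=> cf [A fA].
have [_ h] := @torus_int_has_sum R (fun n u => f u * term t n u)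
  (fun u => f u * rho t u) _ _ (fun n => continuous_funM cf (@term_cont t n))
  (fun n u => ltac:(rewrite normrM; apply: ler_pM => //; exact: term_bound))
  (has_sumZ A (has_sumZ M (has_sum_expR (3 * K * `|t|))))
  (fun u => has_sumZ (f u) (@term_sum t u)).
have -> : (fun u => rho t u * f u) = (fun u => f u * rho t u).
  by apply/funext => u; rewrite mulrC.
apply: eq_has_sum h => n.
rewrite (_ : (fun u => _) = (fun u => t ^+ n / n`!%:R * (P2_iter n u * f u))).
  rewrite torus_intZ; first by ring.
  by apply: continuous_funM => //; case: (P2_iter_CT n).
by apply/funext => u; rewrite /term; ring.
Qed.

Lemma rho_CT t : CT (rho t).
Proof.
split.
  apply: (@continuous_has_sum _ _ (term t)
    (fun n _ => M * (n`!%:R^-1 * (3 * K * `|t|) ^+ n))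
    (fun=> M * expR (3 * K * `|t|)) (rho t) 1) => //.
  - by move=> k x; exact: cvg_cst.
  - by move=> x; exact: cvg_cst.
  - by move=> k u; rewrite mul1r.
  - by move=> u; exact: has_sumZ (has_sum_expR _).
move=> u; rewrite /rho; congr egf; apply/funext => n.
by have [_ ->] := P2_iter_CT n.
Qed.

Lemma P2_rho t u : P2 lambda psi (rho t) u = egf (fun n => P2_iter n.+1 u) t.
Proof.
have h := @P2_has_sum (term t) (rho t) _ _ u (@term_cont t) (term_bound t)
  (has_sumZ M (has_sum_expR (3 * K * `|t|))) (@term_sum t).
apply: (has_sum_unique h).
apply: eq_has_sum (egf_has_sum (shift_growth (growth u)) t) => n.
have e : P2 lambda psi (term t n) u = t ^+ n / n`!%:R * P2_iter n.+1 u.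
  by apply: P2Z; case: (P2_iter_CT n).
by rewrite e; ring.
Qed.

Lemma rho0 : rho 0 = phi.
Proof. by apply/funext => u; exact: (egf0 (growth u)). Qed.

Lemma rho_taylor t h u :
  `|rho (t + h) u - rho t u - h * P2 lambda psi (rho t) u|
   <= M * (3 * K) * (3 * K) * expR (3 * K * (`|t| + `|h|)) * `|h| ^+ 2.
Proof. by rewrite P2_rho; exact: egf_taylor. Qed.

End Solution.

End LimitOperator.

(** * Existence and uniqueness for the limiting equation *)

Section Supnorm.
Variable R : realType.
Implicit Types (f : R -> R) (B : R).

Lemma torus1 : torus (1 : R).
Proof. by rewrite /torus/= in_itv/= ltr01 lexx. Qed.

Lemma supnorm_le f B : (forall u, `|f u| <= B) -> supnorm f <= B.
Proof.
move=> fB; apply: ge_sup; first by exists `|f 1|; exists 1 => //; exact: torus1.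
by move=> _ [u _ <-].
Qed.

Lemma le_supnorm f B u : (forall u, `|f u| <= B) -> torus u -> `|f u| <= supnorm f.
Proof.
move=> fB tu; apply: sup_ubound; last by exists u.
by exists B => _ [v _ <-].
Qed.

Lemma supnorm_ge0 f B : (forall u, `|f u| <= B) -> 0 <= supnorm f.
Proof. by move=> fB; apply: le_trans (le_supnorm fB torus1). Qed.

End Supnorm.

Section Monotonicity.
Variable R : realType.

Lemma is_derive_pow n (x : R) :
  is_derive x (1 : R) (fun y => y ^+ n.+1) (n.+1%:R * x ^+ n).
Proof.
elim: n => [|n IH].
  by rewrite expr0 mulr1; exact: is_derive_id.
have := is_derive_funM (is_derive_id x (1 : R)) IH; rewrite mul1r.
congr is_derive; rewrite /= exprS mulrCA -exprS -[n.+2%:R]natr1; ring.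
Qed.

Lemma nonneg_derive_le (f df : R -> R) (s : R) : 0 < s ->
  (forall x : R, 0 < x -> is_derive x (1 : R) f (df x)) ->
  f x @[x --> (0 : R)^'+] --> f 0 -> (forall x : R, 0 < x < s -> 0 <= df x) ->
  f 0 <= f s.
Proof.
move=> s0 fd f0 dfp.
have fc (x : R) : 0 < x -> {for x, continuous f}.
  by move=> x0; apply: differentiable_continuous; apply/derivable1_diffP; case: (fd x x0).
have wc : {within `[0, s], continuous f}.
  apply/continuous_within_itvP => //; split => //.
    by move=> x; rewrite in_itv/= => /andP[x0 _]; exact: fc.
  by apply: cvg_at_left_filter; exact: fc.
have fd' (x : R) : x \in `]0, s[ -> is_derive x (1 : R) f (df x).
  by rewrite in_itv/= => /andP[x0 _]; exact: fd.
have [c] := MVT s0 fd' wc; rewrite in_itv/= subr0 => cs e.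
by rewrite -subr_ge0 e mulr_ge0 ?dfp// ltW.
Qed.

End Monotonicity.

Section Ode.
Variables (R : realType) (lambda : nat -> R * R -> R) (psi : nat -> R -> R).
Variable K : R.
Hypothesis reg : regular_rates lambda psi K.
Variable phi : R -> R.
Hypothesis phiCT : CT phi.

Let K0 : 0 <= K := rates_bound_ge0 reg.
Let K30 : 0 <= 3 * K. Proof. by rewrite mulr_ge0. Qed.

(** The Taylor remainder is quadratic in [h], uniformly on the torus, so the
    difference quotients converge at speed [h] in the sup norm. *)
Lemma rho_ode : ode_solution lambda psi phi (rho lambda psi phi).
Proof.
have [M phiM] := CT_bounded phiCT.
have M0 : 0 <= M by exact: le_trans (phiM 0).
split.
- by move=> t _; exact: (rho_CT reg phiCT phiM t).
- exact: (rho0 reg phiCT phiM).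
move=> t t0; pose C := M * (3 * K) * (3 * K) * expR (3 * K * (`|t| + 1)).
have C0 : 0 <= C by rewrite !mulr_ge0// ?expR_ge0.
have quot h u : h != 0 -> `|h| <= 1 ->
    `|h^-1 * (rho lambda psi phi (t + h) u - rho lambda psi phi t u)
      - P2 lambda psi (rho lambda psi phi t) u| <= C * `|h|.
  move=> h0 h1; have hT := rho_taylor reg phiCT phiM t h u.
  rewrite -[X in _ - X](mulKf h0) -mulrBr normrM normfV ler_pdivrMl ?normr_gt0//.
  apply: le_trans hT _; rewrite [leRHS]mulrCA -expr2.
  rewrite ler_wpM2r ?sqr_ge0// ler_wpM2l ?mulr_ge0// ler_expR ler_wpM2l//.
  by rewrite lerD2l.
have lin0 : C * `|h| @[h --> within [set h | 0 <= t + h] (0 : R)^'] --> (0 : R).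
  rewrite -[X in _ --> X](mulr0 C); apply: cvgMl_tmp.
  rewrite -[X in _ --> X](@normr0 _ R); apply: cvg_norm.
  by apply: cvg_within_filter; apply: cvg_within_filter; exact: cvg_id.
apply: (@squeeze_cvgr _ _ _ _ (fun=> 0) (fun h => C * `|h|)) lin0; last exact: cvg_cst.
rewrite near_withinE; near=> h => _.
have h0 : h != 0 by near: h; exact: nbhs_dnbhs_neq.
have h1 : `|h| <= 1 by near: h; exact: dnbhs0_le.
apply/andP; split.
  by apply: (@supnorm_ge0 _ _ (C * `|h|)) => u; exact: quot.
by apply: supnorm_le => u; exact: quot.
Unshelve. all: by end_near. Qed.

(** The supremum over the torus bounds the quotients everywhere, by periodicity. *)
Lemma ode_quotient (r : R -> R -> R) (t e : R) : ode_solution lambda psi phi r ->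
  0 <= t -> 0 < e ->
  \forall h \near (0 : R), h != 0 -> 0 <= t + h -> forall u,
    `|h^-1 * (r (t + h) u - r t u) - P2 lambda psi (r t) u| <= e.
Proof.
move=> [rCT _ rd] t0 e0.
have /cvgrPdist_lt/(_ e e0) := rd t t0.
rewrite near_withinE near_withinE; apply: filterS => h hh h0 th u.
have := hh h0 th; rewrite sub0r normrN => {}hh.
set F := fun u => _ in hh.
have [B1 hB1] := CT_bounded (rCT _ th); have [B2 hB2] := CT_bounded (rCT _ t0).
have [B3 hB3] := CT_bounded (P2_CT reg (rCT _ t0)).
have FB v : `|F v| <= `|h^-1| * (B1 + B2) + B3.
  rewrite (le_trans (ler_normB _ _))// lerD// normrM ler_wpM2l//.
  by rewrite (le_trans (ler_normB _ _))// lerD.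
have pF : periodic F 1.
  move=> v; rewrite /F (rCT _ th).2 (rCT _ t0).2.
  by rewrite (P2_CT reg (rCT _ t0)).2.
rewrite -/(F u) -(periodic_torus_repr u pF).
apply: le_trans (le_supnorm FB (torus_repr_in u)) _.
exact: le_trans (ler_norm _) (ltW hh).
Qed.

Section Uniqueness.
Variables (r1 r2 : R -> R -> R).
Hypotheses (sol1 : ode_solution lambda psi phi r1) (sol2 : ode_solution lambda psi phi r2).

Let w s u := r1 s u - r2 s u.
Let dw s u := P2 lambda psi (r1 s) u - P2 lambda psi (r2 s) u.

Let CT1 (s : R) : 0 <= s -> CT (r1 s). Proof. by case: sol1 => + _ _; exact. Qed.
Let CT2 (s : R) : 0 <= s -> CT (r2 s). Proof. by case: sol2 => + _ _; exact. Qed.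

Let dw_bound (s B : R) : 0 <= s -> (forall u, `|w s u| <= B) -> forall u, `|dw s u| <= B * (3 * K).
Proof.
move=> s0 wB u; have [c1 _] := CT1 s0; have [c2 _] := CT2 s0.
rewrite /dw -(P2B reg)//; apply: (P2_bound reg) => //.
exact: continuous_funB.
Qed.

Let w_quotient (s e : R) : 0 <= s -> 0 < e ->
  \forall h \near (0 : R), h != 0 -> 0 <= s + h -> forall u,
    `|h^-1 * (w (s + h) u - w s u) - dw s u| <= e.
Proof.
move=> s0 e0; have e2 : 0 < e / 2 by rewrite divr_gt0.
have h1 := ode_quotient sol1 s0 e2; have h2 := ode_quotient sol2 s0 e2.
apply: filterS2 h1 h2 => h q1 q2 h0 sh u.
have {}q1 := q1 h0 sh u; have {}q2 := q2 h0 sh u.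
rewrite /w /dw.
rewrite (_ : _ - _ = (h^-1 * (r1 (s + h) u - r1 s u) - P2 lambda psi (r1 s) u)
  - (h^-1 * (r2 (s + h) u - r2 s u) - P2 lambda psi (r2 s) u)); last by ring.
rewrite (le_trans (ler_normB _ _))//; lra.
Qed.

Let w_local_bound (s : R) : 0 <= s ->
  exists B : R, \forall s' \near s, 0 <= s' -> forall u, `|w s' u| <= B.
Proof.
move=> s0; have [B1 hB1] := CT_bounded (CT1 s0); have [B2 hB2] := CT_bounded (CT2 s0).
have wB u : `|w s u| <= B1 + B2 by rewrite (le_trans (ler_normB _ _))// lerD.
have B0 : 0 <= B1 + B2 by exact: le_trans (wB 0).
exists (B1 + B2 + (1 + (B1 + B2) * (3 * K))).
have : \forall h \near (0 : R), h != 0 -> 0 <= s + h -> forall u,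
    `|h^-1 * (w (s + h) u - w s u) - dw s u| <= 1 by exact: w_quotient.
move=> /nbhs_ballP[e /= e0 he].
apply/nbhs_ballP; exists (Num.min e 1) => /=; first by rewrite lt_min e0 ltr01.
move=> s'; rewrite /ball/= lt_min => /andP[s'e s'1] s'0 u.
have [->|ss'] := eqVneq s' s.
  by rewrite (le_trans (wB u))// lerDl addr_ge0// mulr_ge0.
have h0 : s' - s != 0 by rewrite subr_eq0.
have := he (s' - s); rewrite /ball/= sub0r opprB => /(_ s'e h0).
rewrite addrC subrK => /(_ s'0 u) hq.
have dB := dw_bound s0 wB u.
have hd : `|(s' - s)^-1 * (w s' u - w s u)| <= 1 + (B1 + B2) * (3 * K).
  rewrite -[X in `|X|](subrK (dw s u)) (le_trans (ler_normD _ _))// lerD//.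
have hi : `|w s' u - w s u| <= 1 + (B1 + B2) * (3 * K).
  rewrite -[X in `|X|](mulVKf h0) normrM.
  apply: le_trans (_ : 1 * `|(s' - s)^-1 * (w s' u - w s u)| <= _); last by rewrite mul1r.
  by rewrite ler_wpM2r// distrC ltW.
rewrite -[X in `|X|](subrK (w s u)) (le_trans (ler_normD _ _))// addrC lerD//.
Qed.

(** The difference quotients bound the solutions only near each time, with no
    uniformity; compactness of the time interval provides it. *)
Let w_bound (T : R) : exists2 B : R, 0 <= B & forall s, 0 <= s <= T -> forall u, `|w s u| <= B.
Proof.
have cK : compact (`[0, T]%classic : set R) by exact: segment_compact.
pose Q (B : R) (s : R) := 0 <= s -> forall u, `|w s u| <= B.
have : \forall B \near +oo%R, (`[0, T]%classic : set R) `<=` Q B.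
  apply: ((compact_near_coveringP _).1 cK) => s; rewrite /= in_itv/= => /andP[s0 _].
  have [B hB] := w_local_bound s0.
  exists ([set s' | 0 <= s' -> forall u, `|w s' u| <= B], [set B' | B <= B']) => /=.
    by split=> //; apply: nbhs_pinfty_ge; exact: num_real.
  move=> [s' B'] /= [h BB'] s'0 u; exact: le_trans (h s'0 u) BB'.
move=> [B [_ hB]]; exists (`|B| + 1); first by rewrite addr_ge0.
move=> s sT; have /andP[s0 _] := sT.
apply: (hB (`|B| + 1)) => //.
by rewrite (le_lt_trans (ler_norm B))// ltrDl.
Qed.

Let w_derive (s u : R) : 0 < s -> is_derive s (1 : R) (w ^~ u) (dw s u).
Proof.
move=> s0.
suff h : h^-1 *: (w (h *: (1 : R) + s) u - w s u) @[h --> (0 : R)^'] --> dw s u.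
  split; first by apply: cvgP h.
  exact: (cvg_lim _ h).
apply/cvgrPdist_le => e e0.
have hq := w_quotient (ltW s0) e0.
have hs : \forall h \near (0 : R), `|h| <= s by exact: nbhs0_le.
rewrite near_withinE; apply: filterS2 hq hs => h q hle h0.
have sh : 0 <= s + h.
  by move: hle; rewrite ler_norml => /andP[+ _]; lra.
rewrite distrC (_ : h *: 1 = h :> R); last exact: mulr1.
by rewrite [h + s]addrC; exact: q.
Qed.

Let w0 u : w 0 u = 0.
Proof. by case: sol1 sol2 => _ + _ [_ + _]; rewrite /w => -> ->; rewrite subrr. Qed.

Let w_cont u : w s u @[s --> (0 : R)^'+] --> w 0 u.
Proof.
rewrite w0; apply/cvgr0Pnorm_le => e e0.
have /nbhs_ballP[r /= r0 hr] := w_quotient (lexx 0) (@ltr01 R).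
pose C := 1 + `|dw 0 u|; have C0 : 0 < C by rewrite ltr_pwDl.
near=> s.
have s0 : 0 < s by near: s; exact: nbhs_right_gt.
have sr : s < r by near: s; exact: nbhs_right_lt.
have se : s < e / C by near: s; apply: nbhs_right_lt; rewrite divr_gt0.
have bs : `|0 - s| < r by rewrite sub0r normrN gtr0_norm.
have sn0 : s != 0 by rewrite gt_eqF.
have ss : 0 <= 0 + s by rewrite add0r ltW.
have := hr s bs sn0 ss u; rewrite add0r w0 subr0 => hq.
have h1 : `|s^-1 * w s u| <= C.
  by rewrite -[X in `|X|](subrK (dw 0 u)) (le_trans (ler_normD _ _))// lerD2r.
rewrite -[X in `|X|](mulVKf (lt0r_neq0 s0)) normrM gtr0_norm//.
apply: le_trans (ler_wpM2l (ltW s0) h1) _.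
by rewrite -ler_pdivlMr// ltW.
Unshelve. all: by end_near. Qed.

(** Feeding the bound of order [n] into the equation and integrating in time gains a
    factor [3 * K * s / n.+1]. *)
Let w_iterate (T B : R) n : (forall s, 0 <= s <= T -> forall u, `|w s u| <= B) ->
  forall s, 0 <= s <= T -> forall u, `|w s u| <= B * ((3 * K) ^+ n / n`!%:R) * s ^+ n.
Proof.
move=> wB; elim: n => [|n IH] s sT u.
  by rewrite !expr0 fact0 divr1 !mulr1; exact: wB.
have /andP[] := sT; rewrite le_eqVlt => /predU1P[<- _|s0 sleT].
  by rewrite w0 normr0 expr0n mulr0.
pose c := B * ((3 * K) ^+ n.+1 / n.+1`!%:R).
have cE : c * n.+1%:R = B * ((3 * K) ^+ n / n`!%:R) * (3 * K).
  have a0 : n.+1%:R != 0 :> R by rewrite pnatr_eq0.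
  rewrite /c factS natrM exprS invfM; move: a0.
  move: (n`!%:R^-1) (n.+1%:R) => b a a0.
  by field.
have step (sg : R) : `|sg| = 1 -> sg * w s u <= c * s ^+ n.+1.
  move=> sg1; rewrite -subr_ge0.
  pose f x := c * x ^+ n.+1 - sg * w x u.
  pose df x := c * (n.+1%:R * x ^+ n) - sg * dw x u.
  have f0 : f 0 = 0 by rewrite /f expr0n w0 !mulr0 subr0.
  rewrite -[X in X <= _]f0 -/(f s).
  apply: (@nonneg_derive_le _ f df) => //.
  - by move=> x x0; apply: is_derive_funB; apply: is_derive_funZ;
      [exact: is_derive_pow|exact: w_derive].
  - apply: cvgB; last by apply: cvgMl_tmp; exact: w_cont.
    by apply: cvgMl_tmp; apply: cvg_at_right_filter; exact: exprn_continuous.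
  - move=> x /andP[x0 xs]; rewrite subr_ge0 (le_trans (ler_norm _))// normrM sg1 mul1r.
    have xT : 0 <= x <= T by rewrite (ltW x0) (le_trans (ltW xs)).
    rewrite mulrA cE mulrAC; apply: dw_bound; first exact: ltW.
    by move=> v; exact: IH.
rewrite ler_norml lerNl; apply/andP; split.
  by have := step (-1); rewrite normrN normr1 mulN1r => /(_ erefl).
by have := step 1; rewrite normr1 mul1r => /(_ erefl).
Qed.

Lemma ode_unique t : 0 <= t -> r1 t = r2 t.
Proof.
move=> t0; apply/funext => u; apply/eqP; rewrite -subr_eq0 -normr_le0 -/(w t u).
have [B B0 wB] := w_bound t.
have hs := has_sumZ B (has_sum_expR (3 * K * t)).
have h0 : B * (n`!%:R^-1 * (3 * K * t) ^+ n) @[n --> \oo] --> (0 : R).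
  exact: cvg_series_cvg_0 (cvgP _ hs).
rewrite -(cvg_lim _ h0)//; apply: limr_ge; first exact: cvgP h0.
near=> n; have tt : 0 <= t <= t by rewrite t0 lexx.
apply: le_trans (w_iterate n wB tt u) _.
by rewrite (exprMn n (3 * K) t) le_eqVlt; apply/orP; left; apply/eqP; ring.
Unshelve. all: by end_near. Qed.

End Uniqueness.

End Ode.

(** * A comparison principle for transition functions *)

Section DifferenceQuotients.
Variable R : realType.

Lemma is_derive_cvg (f : R -> R) (a df : R) : is_derive a (1 : R) f df ->
  h^-1 * (f (a + h) - f a) @[h --> (0 : R)^'] --> df.
Proof.
move=> [fa <-]; apply: cvg_trans fa; apply: near_eq_cvg.
near=> h; rewrite /= (addrC a h).
by rewrite (_ : h *: 1 = h :> R)//; exact: mulr1.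
Unshelve. all: by end_near. Qed.

Lemma at_right_dnbhs0 : (0 : R)^'+ `=>` (0 : R)^'.
Proof. by move=> A [e e0 h]; exists e => // y ye y0; apply: h => //; rewrite gt_eqF. Qed.

End DifferenceQuotients.

Section Esum.
Variable R : realType.
Local Open Scope ereal_scope.

Lemma esumZl (T : choiceType) (I : set T) (a : T -> \bar R) (c : R) :
  (0 <= c)%R -> (forall i, 0 <= a i) ->
  \esum_(i in I) (c%:E * a i) = c%:E * \esum_(i in I) a i.
Proof.
move=> c0 a0; rewrite /esum -ereal_supZl//; last first.
  by apply/set0P; exists (\sum_(i \in set0) a i); exists set0 => //; exact: fsets_set0.
rewrite image_comp; congr ereal_sup; apply: eq_imagel => A _ /=.
by rewrite ge0_mule_fsumr.
Qed.

Lemma esum_exchange (T U : choiceType) (a : T -> U -> \bar R) :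
  (forall i j, 0 <= a i j) ->
  \esum_(i in [set: T]) \esum_(j in [set: U]) a i j =
  \esum_(j in [set: U]) \esum_(i in [set: T]) a i j.
Proof.
move=> a0; rewrite !esum_esum//.
rewrite (reindex_esum ([set: U] `*`` (fun=> [set: T])) _ (fun z => (z.2, z.1)))//.
split=> //= [[i1 j1] [i2 j2] _ _ [-> ->]//|[i j] _].
by exists (j, i).
Qed.

Lemma esum_seq (T : choiceType) (s : seq T) (a : T -> \bar R) :
  uniq s -> (forall i, 0 <= a i) -> (forall i, i \notin s -> a i = 0) ->
  \esum_(i in [set: T]) a i = \sum_(i <- s) a i.
Proof.
move=> us a0 as0.
rewrite fsbig_seq// -esum_fset//.
rewrite [RHS]esum_mkcond; apply: eq_esum => i _.
by case: ifPn => // /negP; rewrite inE/= => /negP /as0.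
Qed.

End Esum.

Section Comparison.
Variables (R : realType) (S : choiceType) (p : R -> S -> S -> R).
Hypothesis tp : transition_function p.

Let p_ge0 (t : R) x y : 0 <= t -> 0 <= p t x y. Proof. by case: tp => + _ _ _; exact. Qed.

Definition semigroup (t : R) (W : S -> R) (x : S) : \bar R :=
  (\esum_(y in [set: S]) (p t x y * W y)%:E)%E.

Section BoundedFunction.
Variables (W : S -> R) (M : R).
Hypotheses (W0 : forall y, 0 <= W y) (WM : forall y, W y <= M).

Lemma semigroup_ge0 t x : 0 <= t -> (0 <= semigroup t W x)%E.
Proof. by move=> t0; apply: esum_ge0 => y _; rewrite lee_fin mulr_ge0// p_ge0. Qed.

Lemma semigroup_le t x : 0 <= t -> (semigroup t W x <= M%:E)%E.
Proof.
move=> t0; have M0 : 0 <= M by exact: le_trans (W0 x) (WM x).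
apply: (@le_trans _ _ (\esum_(y in [set: S]) (M%:E * (p t x y)%:E))%E).
  by apply: le_esum => y _; rewrite -EFinM lee_fin mulrC ler_wpM2r// p_ge0.
rewrite esumZl//; last by move=> y; rewrite lee_fin p_ge0.
by case: tp => _ -> // _ _; rewrite mule1.
Qed.

Lemma semigroup_fin t x : 0 <= t -> semigroup t W x \is a fin_num.
Proof.
move=> t0; rewrite ge0_fin_numE ?semigroup_ge0//.
by rewrite (le_lt_trans (semigroup_le _ _)) ?ltry.
Qed.

Lemma semigroup0 x : semigroup 0 W x = (W x)%:E.
Proof.
have p0 y : p 0 x y = (x == y)%:R by case: tp.
rewrite /semigroup (@esum_seq _ _ [:: x])//.
- by rewrite big_seq1 p0 eqxx mul1r.
- by move=> y; rewrite lee_fin mulr_ge0// p_ge0.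
- by move=> y; rewrite inE p0 eq_sym => /negbTE ->; rewrite mul0r.
Qed.

Lemma semigroupD h t x : 0 <= h -> 0 <= t ->
  semigroup (h + t) W x =
  (\esum_(y in [set: S]) ((p h x y)%:E * semigroup t W y))%E.
Proof.
move=> h0 t0; rewrite /semigroup.
under [RHS]eq_esum => y _.
  rewrite -esumZl//; last 2 first.
  - exact: p_ge0.
  - by move=> z; rewrite lee_fin mulr_ge0// p_ge0.
  over.
rewrite /= esum_exchange; last first.
  by move=> y z; rewrite -EFinM lee_fin !mulr_ge0// p_ge0.
apply: eq_esum => z _.
under eq_esum => y _ do rewrite -EFinM mulrA mulrC EFinM.
rewrite esumZl//; last by move=> y; rewrite lee_fin mulr_ge0// p_ge0.
by case: tp => _ _ _ /(_ _ _ _ _ h0 t0) <-; rewrite -EFinM mulrC.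
Qed.

(** An upper bound for the semigroup at a later time that involves only finitely
    many transition probabilities: it combines the honesty of [p] with the deficits
    [c y] to the level [M] at the points of [s]. *)
Lemma semigroupD_le h t x (s : seq S) (c : S -> R) : 0 <= h -> 0 <= t ->
  uniq s -> (forall y, y \in s -> 0 <= c y) ->
  (forall y, y \in s -> (semigroup t W y <= (M - c y)%:E)%E) ->
  (semigroup (h + t) W x <= (M - \sum_(y <- s) p h x y * c y)%:E)%E.
Proof.
move=> h0 t0 us c0 Uc; rewrite semigroupD//.
have M0 : 0 <= M by exact: le_trans (W0 x) (WM x).
pose c' y := if y \in s then c y else 0.
have c'0 y : 0 <= c' y by rewrite /c'; case: ifP => // /c0.
have Uc' y : (semigroup t W y <= (M - c' y)%:E)%E.
  by rewrite /c'; case: ifPn => [/Uc//|_]; rewrite subr0 semigroup_le.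
have Mc y : 0 <= M - c' y.
  by rewrite -lee_fin; exact: le_trans (semigroup_ge0 _ t0) (Uc' y).
have pe y : (0 <= (p h x y)%:E)%E by rewrite lee_fin p_ge0.
rewrite EFinB leeBrDr//.
have <- : (\esum_(y in [set: S]) (p h x y * c' y)%:E =
           (\sum_(y <- s) p h x y * c y)%:E)%E.
  rewrite (@esum_seq _ _ s)// ?sumEFin.
  - congr EFin; apply: eq_big_seq => y ys.
    by rewrite /c' ys.
  - by move=> y; rewrite lee_fin mulr_ge0// p_ge0.
  - by move=> y ys; rewrite /c' (negbTE ys) mulr0.
have U0 y := semigroup_ge0 y t0.
rewrite -esumD; last 2 first.
- by move=> y _; rewrite mule_ge0.
- by move=> y _; rewrite lee_fin mulr_ge0// p_ge0.
apply: (@le_trans _ _ (\esum_(y in [set: S]) (M%:E * (p h x y)%:E))%E).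
  apply: le_esum => y _; rewrite EFinM [leRHS]muleC.
  rewrite -ge0_muleDr//; last by rewrite lee_fin.
  by apply: lee_wpmul2l => //; rewrite -leeBrDr// -EFinB.
rewrite esumZl//.
by case: tp => _ -> // _ _; rewrite mule1.
Qed.

End BoundedFunction.

Variable q : S -> S -> R.
Hypothesis generator : forall x y,
  t^-1 * (p t x y - (x == y)%:R) @[t --> (0 : R)^'+] --> q x y.

Let right_cvg0 : (t : R) @[t --> (0 : R)^'+] --> (0 : R).
Proof. exact: cvg_within_filter. Qed.

Lemma transition_cvg1 x : p t x x @[t --> (0 : R)^'+] --> (1 : R).
Proof.
have h : t * (t^-1 * (p t x x - (x == x)%:R)) + 1 @[t --> (0 : R)^'+] --> (1 : R).
  rewrite -[X in _ --> X]add0r -[X in _ --> X + _](mul0r (q x x)).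
  by apply: cvgD; [exact: cvgM|exact: cvg_cst].
apply: cvg_trans h; apply: near_eq_cvg; near=> t.
rewrite /= eqxx mulrA mulfV ?mul1r ?subrK//.
Unshelve. all: by end_near. Qed.

(** If the semigroup exceeded [v] somewhere, consider the infimum [t0] of such
    times. At [t0] it still lies below [v], and truncating [v] at the level [M]
    turns the difference to [M] into a function supported in [s]. Hence the
    increment after [t0], at a point where the two functions touch, is controlled
    by finitely many entries of the generator and loses against the growth
    of [v]. *)
Lemma comparison (v dv : R -> S -> R) (W : S -> R) (M T : R) (s : seq S) :
  uniq s -> (forall y, 0 <= W y) -> (forall y, W y <= M) ->
  (forall y, W y <= v 0 y) ->
  (forall t x, is_derive (t : R) (1 : R) (v ^~ x : R -> R) (dv t x)) ->
  (forall (t : R) x, 0 <= t <= T -> x \notin s -> M <= v t x) ->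
  (forall (t : R) x, 0 <= t <= T -> x \in s -> 0 <= v t x -> v t x <= M ->
    - dv t x < \sum_(y <- s) q x y * (M - Num.min (v t y) M)) ->
  forall (t : R) x, 0 <= t <= T -> (semigroup t W x <= (v t x)%:E)%E.
Proof.
move=> us W0 WM Wv0 vd vM super.
pose good t := forall x, (semigroup t W x <= (v t x)%:E)%E.
suff : forall t : R, 0 <= t <= T -> good t by move=> h t x /h.
apply: contrapT => /existsNP[t1 /not_implyP[t1T bad1]].
pose E := [set t : R | 0 <= t <= T /\ ~ good t].
have E1 : E t1 by [].
have hE : has_inf E by split; [exists t1|exists 0 => t [/andP[]]].
pose t0 := inf E.
have t00 : 0 <= t0 by apply: lb_le_inf; [exists t1|move=> t [/andP[]]].
have t01 : t0 <= t1 by apply: ge_inf => //; case: hE.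
have t0T : 0 <= t0 <= T by case/andP: t1T => _; rewrite t00; exact: le_trans.
have before (t : R) : 0 <= t < t0 -> good t.
  move=> /andP[tge tlt]; apply: contrapT => bad.
  have : t0 <= t.
    apply: ge_inf; first by case: hE.
    by split=> //; rewrite tge (le_trans (ltW tlt))//; case/andP: t0T.
  by rewrite leNgt tlt.
have vcont x t : {for t, continuous (v ^~ x)}.
  by apply: differentiable_continuous; apply/derivable1_diffP; case: (vd t x).
have vc x : v (t0 + h) x @[h --> (0 : R)^'+] --> v t0 x.
  have h1 : t0 + h @[h --> (0 : R)^'+] --> t0.
    by rewrite -[X in _ --> X]addr0; apply: cvgD => //; exact: cvg_cst.
  exact: (cvg_comp _ _ h1 (vcont x t0)).
have vcm x : v (t0 - h) x @[h --> (0 : R)^'+] --> v t0 x.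
  have h1 : t0 - h @[h --> (0 : R)^'+] --> t0.
    by rewrite -[X in _ --> X]subr0; apply: cvgB => //; exact: cvg_cst.
  exact: (cvg_comp _ _ h1 (vcont x t0)).
have good0 : good t0.
  move: (t00); rewrite le_eqVlt => /predU1P[<- x|t0pos x].
    by rewrite (semigroup0 W0) lee_fin.
  have Ufin := semigroup_fin W0 WM x t00.
  rewrite -(fineK Ufin) lee_fin.
  have hcv : M - p h x x * (M - v (t0 - h) x) @[h --> (0 : R)^'+] --> v t0 x.
    rewrite [X in _ --> X](_ : _ = M - 1 * (M - v t0 x)); last by ring.
    apply: cvgB; first exact: cvg_cst.
    apply: cvgM; first exact: transition_cvg1.
    by apply: cvgB => //; exact: cvg_cst.
  rewrite -(cvg_lim _ hcv)//; apply: limr_ge; first exact: cvgP hcv.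
  near=> h.
  have h0 : 0 < h by near: h; exact: nbhs_right_gt.
  have ht0 : h < t0 by near: h; exact: nbhs_right_lt.
  have th0 : 0 <= t0 - h < t0 by rewrite subr_ge0 (ltW ht0) ltrBlDr ltrDl.
  have thge0 : 0 <= t0 - h by case/andP: th0.
  have th := before _ th0.
  have := @semigroupD_le W M W0 WM h (t0 - h) x [:: x]
    (fun y => M - fine (semigroup (t0 - h) W y)) (ltW h0) thge0.
  rewrite addrCA subrr addr0 big_seq1 => H.
  have {}H : (semigroup t0 W x <=
      (M - p h x x * (M - fine (semigroup (t0 - h) W x)))%:E)%E.
    apply: H => // y _.
      rewrite subr_ge0 -lee_fin fineK; last exact: (semigroup_fin W0 WM).
      exact: (semigroup_le W0 WM).
    rewrite subKr fineK//; exact: (semigroup_fin W0 WM).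
  rewrite -lee_fin fineK//; apply: le_trans H _.
  rewrite lee_fin lerD2l lerN2 ler_wpM2l ?p_ge0 ?(ltW h0)// lerD2l lerN2.
  by rewrite -lee_fin fineK//; exact: (semigroup_fin W0 WM).
pose U x := fine (semigroup t0 W x).
have UE x : semigroup t0 W x = (U x)%:E by rewrite /U fineK// (semigroup_fin W0 WM).
have UM x : U x <= M by rewrite -lee_fin -UE (semigroup_le W0 WM).
have U0 x : 0 <= U x by rewrite -lee_fin -UE (semigroup_ge0 W0).
have Uv x : U x <= v t0 x by rewrite -lee_fin -UE.
have after x : x \in s ->
    \forall h \near (0 : R)^'+, (semigroup (h + t0) W x <= (v (t0 + h) x)%:E)%E.
  move=> xs; have := Uv x; rewrite le_eqVlt => /predU1P[Ue|Ult].
  - (* At a contact point the right derivatives decide. *)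
    pose c y := M - Num.min (v t0 y) M.
    have cx : c x = M - U x by rewrite /c -Ue min_l.
    have c0 y : 0 <= c y by rewrite subr_ge0 ge_min lexx orbT.
    have hq : \sum_(y <- s) h^-1 * (p h x y - (x == y)%:R) * c y
        @[h --> (0 : R)^'+] --> \sum_(y <- s) q x y * c y.
      by apply: cvg_bigsum => y _; apply: cvgM => //; exact: cvg_cst.
    have hd : h^-1 * (v (t0 + h) x - v t0 x) @[h --> (0 : R)^'+] --> dv t0 x.
      apply: cvg_trans (is_derive_cvg (vd t0 x)); apply: cvg_app.
      exact: at_right_dnbhs0.
    have hpos := super _ _ t0T xs.
    have {}hpos : 0 < dv t0 x + \sum_(y <- s) q x y * c y.
      by rewrite -ltrBlDl sub0r; apply: hpos; rewrite -Ue.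
    have hsum : h^-1 * (v (t0 + h) x - v t0 x) +
        \sum_(y <- s) h^-1 * (p h x y - (x == y)%:R) * c y
        @[h --> (0 : R)^'+] --> dv t0 x + \sum_(y <- s) q x y * c y.
      exact: cvgD.
    near=> h.
    have h0 : 0 < h by near: h; exact: nbhs_right_gt.
    have : 0 < h^-1 * (v (t0 + h) x - v t0 x) +
        \sum_(y <- s) h^-1 * (p h x y - (x == y)%:R) * c y.
      by near: h; exact: (cvgr_gt _ hsum _ hpos).
    have -> : \sum_(y <- s) h^-1 * (p h x y - (x == y)%:R) * c y =
        h^-1 * (\sum_(y <- s) p h x y * c y - c x).
      rewrite (bigD1_seq x)//= eqxx [in RHS](bigD1_seq x)//=.
      have -> : \sum_(y <- s | y != x) h^-1 * (p h x y - (x == y)%:R) * c y =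
          h^-1 * \sum_(y <- s | y != x) p h x y * c y.
        rewrite mulr_sumr; apply: eq_bigr => y yx.
        by rewrite eq_sym (negbTE yx) subr0 mulrA.
      by ring.
    rewrite -mulrDr pmulr_rgt0 ?invr_gt0// cx -Ue => hh.
    apply: le_trans (semigroupD_le W0 WM x (ltW h0) t00 us _ _ (c := c)) _.
    + by move=> y _; exact: c0.
    + by move=> y _; rewrite UE lee_fin /c subKr le_min Uv UM.
    + by rewrite lee_fin; lra.
  - have h1 : M - p h x x * (M - U x) @[h --> (0 : R)^'+] --> U x.
      rewrite [X in _ --> X](_ : _ = M - 1 * (M - U x)); last by ring.
      apply: cvgB; first exact: cvg_cst.
      by apply: cvgM; [exact: transition_cvg1|exact: cvg_cst].
    have h2 : v (t0 + h) x - (M - p h x x * (M - U x)) @[h --> (0 : R)^'+]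
        --> v t0 x - U x by exact: cvgB.
    near=> h.
    have h0 : 0 < h by near: h; exact: nbhs_right_gt.
    have : 0 < v (t0 + h) x - (M - p h x x * (M - U x)).
      by near: h; apply: (cvgr_gt _ h2); rewrite subr_gt0.
    rewrite subr_gt0 => /ltW h3.
    have := @semigroupD_le W M W0 WM h t0 x [:: x] (fun y => M - U y) (ltW h0) t00.
    rewrite big_seq1 => H; apply: le_trans (H _ _ _) _ => //.
    + by move=> y _; rewrite subr_ge0.
    + by move=> y _; rewrite subKr UE.
have : \forall h \near (0 : R)^'+, forall x, x \in s ->
    (semigroup (h + t0) W x <= (v (t0 + h) x)%:E)%E.
  elim: (s) after => [|y r IH] ha; first by near=> h.
  have h1 : \forall h \near (0 : R)^'+, (semigroup (h + t0) W y <= (v (t0 + h) y)%:E)%E.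
    by apply: ha; rewrite inE eqxx.
  have h2 : \forall h \near (0 : R)^'+, forall x, x \in r ->
      (semigroup (h + t0) W x <= (v (t0 + h) x)%:E)%E.
    by apply: IH => x xr; apply: ha; rewrite inE xr orbT.
  near=> h => x; rewrite inE => /predU1P[->|xr]; first by near: h.
  by move: x xr; near: h.
rewrite near_withinE => -[e /= e0 he].
have [t [tT badt] tlt] := inf_adherent e0 hE.
have t0t : t0 <= t by apply: ge_inf => //; case: hE.
move: t0t; rewrite le_eqVlt => /predU1P[tt|t0t]; first by apply: badt; rewrite -tt.
apply: badt => x; have [xs|xs] := boolP (x \in s); last first.
  by rewrite (le_trans (semigroup_le W0 WM _ _)) ?lee_fin ?vM//; case/andP: tT.
have ball_t : `|0 - (t - t0)| < e.
  rewrite sub0r normrN ger0_norm ?subr_ge0 ?(ltW t0t)//.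
  by rewrite ltrBlDl.
have tt0 : 0 < t - t0 by rewrite subr_gt0.
have := he (t - t0) ball_t tt0 x xs.
by rewrite subrK addrC subrK.
Unshelve. all: by end_near. Qed.

End Comparison.

(** * The generator on quadratic functions *)

Section UrnGenerator.
Variables (R : realType) (lambda : nat -> R * R -> R) (psi : nat -> R -> R).
Variable K : R.
Hypothesis reg : regular_rates lambda psi K.

Let K0 : 0 <= K := rates_bound_ge0 reg.

Variable N : nat.
Hypothesis N0 : (0 < N)%N.
Local Notation conf := (config N).
Implicit Types (i j l : 'I_N) (x y z : conf) (g : 'I_N -> R).

(** The jump from [i] to [j] is [branch x i j k] also for [j = i], which lets the
    two kinds of events of the process be treated together. *)
Definition urn_rate i j (k : nat) : R :=
  if j == i then psi k (urn_pos R i)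
  else N%:R^-1 * lambda k (urn_pos R i, urn_pos R j).

Lemma urn_rate_ge0 i j k : 0 <= urn_rate i j k.
Proof.
rewrite /urn_rate; case: ifP => _; first exact: (rates_psi_ge0 reg).
by rewrite mulr_ge0// (rates_lambda_ge0 reg).
Qed.

Definition urn_moment i j : R :=
  \sum_(k <oo) ((k%:R + 1) ^+ 2 * urn_rate i j k).

Let moment_spec i j :
  has_sum (fun k => (k%:R + 1) ^+ 2 * urn_rate i j k) (urn_moment i j) /\
  urn_moment i j <= N%:R^-1 * K + (j == i)%:R * K.
Proof.
suff [s hs sK] : exists2 s, has_sum (fun k => (k%:R + 1) ^+ 2 * urn_rate i j k) s &
    s <= N%:R^-1 * K + (j == i)%:R * K.
  by have ss := has_sum_lim hs; rewrite /urn_moment ss.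
rewrite /urn_rate; case: eqVneq => [_|_].
  have [s hs sK] := rates_psi_moment reg (urn_pos R i).
  by exists s => //; rewrite mul1r (le_trans sK)// lerDr mulr_ge0.
have [s hs sK] := rates_lambda_moment reg (urn_pos R i, urn_pos R j).
exists (N%:R^-1 * s); last by rewrite mul0r addr0 ler_wpM2l.
by apply: eq_has_sum (has_sumZ N%:R^-1 hs) => k; rewrite mulrCA.
Qed.

Lemma urn_moment_has_sum i j :
  has_sum (fun k => (k%:R + 1) ^+ 2 * urn_rate i j k) (urn_moment i j).
Proof. by case: (moment_spec i j). Qed.

Lemma sum_urn_moment_le i : \sum_j urn_moment i j <= 2 * K.
Proof.
apply: (@le_trans _ _ (\sum_j (N%:R^-1 * K + (j == i)%:R * K))).
  by apply: ler_sum => j _; case: (moment_spec i j).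
rewrite big_split/= sumr_const card_ord -[_ *+ N]mulr_natl mulrA mulfV ?mul1r; last first.
  by rewrite pnatr_eq0 -lt0n.
rewrite -mulr_suml (bigD1 i)//= eqxx big1 ?addr0; last by move=> j /negbTE ->.
by rewrite mul1r; lra.
Qed.

Definition urn_mean i j : R := \sum_(k <oo) (k%:R * urn_rate i j k).
Definition urn_total i j : R := \sum_(k <oo) urn_rate i j k.

(** The matrix of the mean evolution: the expected number of particles in urn
    [j] grows at rate [\sum_i x i * drift i j]. *)
Definition drift i j : R := urn_mean i j - (j == i)%:R * \sum_l urn_total i l.

Definition drift_app g i : R := \sum_j drift i j * g j.

Lemma moment_dom (a : nat -> R) i j k : `|a k| <= (k%:R + 1) ^+ 2 ->
  `|a k * urn_rate i j k| <= (k%:R + 1) ^+ 2 * urn_rate i j k.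
Proof. by move=> h; rewrite normrM (ger0_norm (urn_rate_ge0 _ _ _)) ler_wpM2r// urn_rate_ge0. Qed.

Lemma urn_mean_has_sum i j :
  has_sum (fun k => k%:R * urn_rate i j k) (urn_mean i j).
Proof.
apply: (has_sum_dom _ (@urn_moment_has_sum i j)) => k.
apply: (@moment_dom (fun k => k%:R)).
by rewrite ger0_norm//; have : 0 <= k%:R :> R by []; nra.
Qed.

Lemma urn_total_has_sum i j : has_sum (fun k => urn_rate i j k) (urn_total i j).
Proof.
apply: (has_sum_dom _ (@urn_moment_has_sum i j)) => k.
rewrite -[X in `|X|]mul1r; apply: (@moment_dom (fun k => 1)).
by rewrite normr1; have : 0 <= k%:R :> R by []; nra.
Qed.

Lemma sum_delta (F : 'I_N -> R) i : \sum_j (j == i)%:R * F j = F i.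
Proof.
by rewrite (bigD1 i)//= eqxx mul1r big1 ?addr0// => j /negbTE ->; rewrite mul0r.
Qed.

Lemma drift_has_sum g i :
  has_sum (fun k => \sum_j urn_rate i j k * (k%:R * g j - g i)) (drift_app g i).
Proof.
have -> : drift_app g i = \sum_j (g j * urn_mean i j - g i * urn_total i j).
  rewrite /drift_app /drift; under eq_bigr do rewrite mulrBl.
  rewrite !sumrB; congr (_ - _); first by apply: eq_bigr => j _; rewrite mulrC.
  under eq_bigr do rewrite -mulrA; rewrite (sum_delta (fun j => _ * g j)) mulrC.
  by rewrite mulr_sumr.
apply: (@eq_has_sum _ (fun k => \sum_j
  (g j * (k%:R * urn_rate i j k) - g i * urn_rate i j k))).
  by move=> k; apply: eq_bigr => j _; ring.
apply: has_sum_sum => j _; apply: has_sumB; apply: has_sumZ.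
  exact: urn_mean_has_sum.
exact: urn_total_has_sum.
Qed.

Let displacement_le g (G : R) i j k : (forall j, `|g j| <= G) ->
  `|k%:R * g j - g i| <= G * (k%:R + 1).
Proof.
move=> gG; rewrite (le_trans (ler_normB _ _))// mulrDr mulr1 lerD//.
by rewrite normrM normr_nat mulrC ler_wpM2r.
Qed.

Lemma drift_app_bound g (G : R) i :
  (forall j, `|g j| <= G) -> `|drift_app g i| <= 2 * K * G.
Proof.
move=> gG; have G0 : 0 <= G by exact: le_trans (normr_ge0 _) (gG i).
have h : has_sum (fun k => G * \sum_j (k%:R + 1) ^+ 2 * urn_rate i j k)
    (G * \sum_j urn_moment i j).
  by apply: has_sumZ; apply: has_sum_sum => j _; exact: urn_moment_has_sum.
apply: le_trans (ler_norm_has_sum _ (@drift_has_sum g i) h) _ => [k|]; last first.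
  by rewrite mulrC ler_wpM2r// sum_urn_moment_le.
rewrite (le_trans (ler_norm_sum _ _ _))// mulr_sumr; apply: ler_sum => j _.
rewrite normrM (ger0_norm (urn_rate_ge0 _ _ _)) mulrA [leRHS]mulrC.
rewrite ler_wpM2l ?urn_rate_ge0// (le_trans (displacement_le _ _ _ gG))//.
by rewrite ler_wpM2l//; have : 0 <= k%:R :> R by []; nra.
Qed.

Definition jump (F : conf -> R) x (k : nat) : R :=
  \sum_i \sum_j (x i)%:R * urn_rate i j k * (F (branch x i j k) - F x).

(** Increments of size [(k + 1)^2] are summable against the rates by the second
    moment bound; the condition on [x i] discards jumps of rate 0, for which
    [branch] truncates. *)
Lemma generator_has_sum (F : conf -> R) x (C : R) :
  (forall i j k, (0 < x i)%N ->
    `|F (branch x i j k) - F x| <= C * (k%:R + 1) ^+ 2) ->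
  has_sum (jump F x) (urn_generator lambda psi F x).
Proof.
move=> FC.
pose d i j k := (x i)%:R * urn_rate i j k * (F (branch x i j k) - F x).
have dsum i j : has_sum (d i j) (\sum_(k <oo) d i j k).
  apply: (has_sum_dom _ (has_sumZ (x i)%:R (has_sumZ C (@urn_moment_has_sum i j)))).
  move=> k; rewrite /d; have [xi0|xi0] := posnP (x i).
    by rewrite xi0 !mul0r normr0.
  rewrite -mulrA normrM normr_nat ler_wpM2l// normrM.
  rewrite (ger0_norm (urn_rate_ge0 _ _ _)) mulrA [leRHS]mulrC.
  by rewrite ler_wpM2l ?urn_rate_ge0// FC.
have h1 : has_sum (fun k => \sum_i \sum_(j | j != i) d i j k)
    (\sum_i \sum_(j | j != i) (\sum_(k <oo) d i j k)).
  by apply: has_sum_sum => i _; apply: has_sum_sum => j _; exact: dsum.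
have h2 : has_sum (fun k => \sum_i d i i k) (\sum_i (\sum_(k <oo) d i i k)).
  by apply: has_sum_sum => i _; exact: dsum.
have Nn0 : N%:R != 0 :> R by rewrite pnatr_eq0 -lt0n.
rewrite /urn_generator.
have e1 k : \sum_(i < N) \sum_(j < N | j != i) (x i)%:R *
    lambda k (urn_pos R i, urn_pos R j) * (F (branch x i j k) - F x) =
    N%:R * \sum_i \sum_(j | j != i) d i j k.
  rewrite mulr_sumr; apply: eq_bigr => i _; rewrite mulr_sumr; apply: eq_bigr => j.
  by move=> /negbTE ji; rewrite /d /urn_rate ji; field.
have e2 k : \sum_(i < N) (x i)%:R * psi k (urn_pos R i) *
    (F (branch x i i k) - F x) = \sum_i d i i k.
  by apply: eq_bigr => i _; rewrite /d /urn_rate eqxx.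
rewrite (eq_sum_oo e1) (eq_sum_oo e2) (has_sum_lim (has_sumZ N%:R h1)).
rewrite (has_sum_lim h2) mulKf//.
apply: eq_has_sum (has_sumD h1 h2) => k; rewrite -big_split/= /jump.
by apply: eq_bigr => i _; rewrite [RHS](bigD1 i)//= addrC.
Qed.

Definition lin g x : R := \sum_i (x i)%:R * g i.
Definition mass x : R := \sum_i (x i)%:R.

Lemma mass_ge0 x : 0 <= mass x. Proof. by apply: sumr_ge0. Qed.

Lemma branchE x i j k l : (0 < x i)%N ->
  (branch x i j k l)%:R = (x l)%:R - (l == i)%:R + k%:R * (l == j)%:R :> R.
Proof.
move=> xi0; rewrite ffunE natrD natrM natrB//.
by case: eqVneq => // ->.
Qed.

Lemma lin_branch g x i j k : (0 < x i)%N ->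
  lin g (branch x i j k) = lin g x + (k%:R * g j - g i).
Proof.
move=> xi0; rewrite /lin; under eq_bigr do rewrite branchE// mulrDl mulrBl -mulrA.
by rewrite big_split sumrB/= -mulr_sumr !sum_delta -addrA [- _ + _]addrC.
Qed.

Lemma mass_branch x i j k : (0 < x i)%N ->
  mass (branch x i j k) = mass x + (k%:R - 1).
Proof.
have ml z : mass z = lin (fun=> 1) z by apply: eq_bigr => l _; rewrite mulr1.
by move=> xi0; rewrite !ml lin_branch// mulr1.
Qed.

(** Squares of linear functions are mapped to the derivative of the square along
    the drift plus a carre du champ term, and the latter is only linear in the
    number of particles: this is why fluctuations are of smaller order. *)
Lemma generator_quadratic g (G c a b : R) x : (forall j, `|g j| <= G) -> 0 <= a ->
  let V z := (lin g z - c) ^+ 2 + a * mass z + b in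
  has_sum (jump V x) (urn_generator lambda psi V x) /\
  urn_generator lambda psi V x <=
    2 * (lin g x - c) * lin (drift_app g) x + (G ^+ 2 + a) * (2 * K) * mass x.
Proof.
move=> gG a0 V.
have G0 : 0 <= G by exact: le_trans (normr_ge0 _) (gG (Ordinal N0)).
have VE i j k : (0 < x i)%N -> V (branch x i j k) - V x =
    2 * (lin g x - c) * (k%:R * g j - g i) + (k%:R * g j - g i) ^+ 2
    + a * (k%:R - 1).
  by move=> xi0; rewrite /V lin_branch// mass_branch//; ring.
have sq i j k : (k%:R * g j - g i) ^+ 2 <= G ^+ 2 * (k%:R + 1) ^+ 2.
  rewrite -exprMn -[leLHS]real_normK ?num_real// ler_sqr ?nnegrE//.
    exact: displacement_le.
  by rewrite mulr_ge0.
have k1 (k : nat) : `|k%:R - 1| <= (k%:R + 1) ^+ 2 :> R.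
  by rewrite ler_norml; have k0 : 0 <= k%:R :> R by []; apply/andP; split; nra.
have hV : has_sum (jump V x) (urn_generator lambda psi V x).
  apply: (@generator_has_sum V x (2 * `|lin g x - c| * G + G ^+ 2 + a)).
  move=> i j k xi0; rewrite VE// (le_trans (ler_normD _ _))// [leRHS]mulrDl lerD//.
    rewrite (le_trans (ler_normD _ _))// [leRHS]mulrDl lerD//; last first.
      by rewrite ger0_norm ?sqr_ge0.
    rewrite !normrM normr_nat -!mulrA ler_wpM2l// ler_wpM2l//.
    rewrite (le_trans (displacement_le _ _ _ gG))// ler_wpM2l//.
    by have k0 : 0 <= k%:R :> R by []; nra.
  by rewrite normrM (ger0_norm a0) ler_wpM2l.
split=> //.
have h1 : has_sum (fun k => \sum_i (x i)%:R * \sum_j urn_rate i j k * (k%:R * g j - g i))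
    (lin (drift_app g) x).
  by apply: has_sum_sum => i _; apply: has_sumZ; exact: drift_has_sum.
have h2 : has_sum (fun k => \sum_i (x i)%:R * \sum_j (k%:R + 1) ^+ 2 * urn_rate i j k)
    (\sum_i (x i)%:R * \sum_j urn_moment i j).
  apply: has_sum_sum => i _; apply: has_sumZ; apply: has_sum_sum => j _.
  exact: urn_moment_has_sum.
have h3 := has_sumD (has_sumZ (2 * (lin g x - c)) h1) (has_sumZ (G ^+ 2 + a) h2).
apply: le_trans (ler_has_sum _ hV h3) _.
  move=> k; rewrite !mulr_sumr -big_split/= /jump; apply: ler_sum => i _.
  rewrite [X in _ <= X + _]mulrCA [X in _ <= _ + X]mulrCA -mulrDr.
  have -> : \sum_j (x i)%:R * urn_rate i j k * (V (branch x i j k) - V x) =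
      (x i)%:R * \sum_j urn_rate i j k * (V (branch x i j k) - V x).
    by rewrite mulr_sumr; apply: eq_bigr => j _; rewrite mulrA.
  have [->|xi0] := posnP (x i); first by rewrite !mul0r.
  rewrite ler_wpM2l// !mulr_sumr -big_split/=; apply: ler_sum => j _.
  rewrite VE// [leRHS](_ : _ = urn_rate i j k * (2 * (lin g x - c) * (k%:R * g j - g i)
    + (G ^+ 2 + a) * (k%:R + 1) ^+ 2)); last by ring.
  rewrite ler_wpM2l ?urn_rate_ge0// -addrA lerD2l mulrDl lerD// ler_wpM2l//.
  exact: le_trans (ler_norm _) (k1 k).
rewrite lerD2l -mulrA ler_wpM2l ?addr_ge0 ?sqr_ge0// /mass mulr_sumr.
by apply: ler_sum => i _; rewrite mulrC ler_wpM2r// sum_urn_moment_le.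
Qed.

(** The entries of the generator are its values on indicators of configurations.
    The function [M - min v M] is a finite combination of indicators, is at least
    [M - v] and agrees with it at [x]; all jump rates being nonnegative, its
    generator at [x] is at least that of [M - v]. *)
Lemma generator_truncated (s : seq conf) (v : conf -> R) (M : R) x :
  uniq s -> (forall y, y \notin s -> M <= v y) -> v x <= M ->
  has_sum (jump v x) (urn_generator lambda psi v x) ->
  - urn_generator lambda psi v x <=
    \sum_(y <- s) urn_generator lambda psi (fun z => (z == y)%:R) x
      * (M - Num.min (v y) M).
Proof.
move=> us vM vxM hv; pose c y := M - Num.min (v y) M.
have hy y : has_sum (fun k => c y * jump (fun z => (z == y)%:R) x k)
    (c y * urn_generator lambda psi (fun z => (z == y)%:R) x).
  apply: has_sumZ; apply: (@generator_has_sum _ x 1) => i j k _.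
  rewrite mul1r; apply: (@le_trans _ _ 1).
    by case: eqP => _; case: eqP => _; rewrite ?subrr ?subr0 ?sub0r ?normrN ?normr0 ?normr1.
  by have k0 : 0 <= k%:R :> R by []; nra.
have hs : has_sum (fun k => \sum_(y <- s) c y * jump (fun z => (z == y)%:R) x k)
    (\sum_(y <- s) c y * urn_generator lambda psi (fun z => (z == y)%:R) x).
  by apply: has_sum_sum => y _; exact: hy.
under eq_bigr do rewrite mulrC.
have := ler_has_sum _ (has_sumZ (-1) hv) hs; rewrite mulN1r; apply => k.
have -> : \sum_(y <- s) c y * jump (fun z => (z == y)%:R) x k = jump c x k.
  have cE z : \sum_(y <- s) c y * (z == y)%:R = c z.
    have [zs|zs] := boolP (z \in s).
      rewrite (bigD1_seq z)//= eqxx mulr1 big1 ?addr0// => y /negbTE.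
      by rewrite eq_sym => ->; rewrite mulr0.
    rewrite big1_seq; first by rewrite /c min_r ?subrr// vM.
    move=> y /= ys; have [zy|_] := eqVneq z y; last by rewrite mulr0.
    by move: zs; rewrite zy ys.
  under eq_bigr do rewrite mulr_sumr.
  rewrite exchange_big; apply: eq_bigr => i _.
  under eq_bigr do rewrite mulr_sumr.
  rewrite exchange_big; apply: eq_bigr => j _ /=.
  under eq_bigr do rewrite mulrCA mulrBr.
  by rewrite -mulr_sumr sumrB !cE.
rewrite mulN1r /jump -sumrN; apply: ler_sum => i _; rewrite -sumrN.
apply: ler_sum => j _; rewrite -mulrN ler_wpM2l ?mulr_ge0 ?urn_rate_ge0//.
rewrite /c (min_l vxM).
set z := branch _ _ _ _; have : Num.min (v z) M <= v z by rewrite ge_min lexx.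
by lra.
Qed.

Lemma finite_configs (n : nat) : exists s : seq conf,
  uniq s /\ forall x, x \notin s -> n%:R <= mass x.
Proof.
pose emb (h : {ffun 'I_N -> 'I_n.+1}) : conf := [ffun i => nat_of_ord (h i)].
exists (undup [seq emb h | h <- enum {ffun 'I_N -> 'I_n.+1}]).
split; first exact: undup_uniq.
move=> x; rewrite mem_undup => xs; rewrite leNgt; apply/negP => xn.
have xi i : (x i < n.+1)%N.
  rewrite ltnS -(ler_nat R); apply: le_trans (ltW xn).
  by rewrite /mass (bigD1 i)//= lerDl sumr_ge0.
move/negP: xs; apply; apply/mapP; exists [ffun i => Ordinal (xi i)].
  by rewrite mem_enum.
by apply/ffunP => i; rewrite !ffunE.
Qed.

Definition flow (f : 'I_N -> R) (t : R) i : R :=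
  egf (fun n => iter n drift_app f i) t.

Section Flow.
Variables (f : 'I_N -> R) (A : R).
Hypothesis fA : forall i, `|f i| <= A.

Lemma iter_drift_bound n i : `|iter n drift_app f i| <= A * (2 * K) ^+ n.
Proof.
elim: n i => [|n IH] i; first by rewrite expr0 mulr1.
by rewrite iterS (le_trans (drift_app_bound _ IH))// exprS mulrCA.
Qed.

Let growth i : forall n, `|iter n drift_app f i| <= A * (2 * K) ^+ n.
Proof. by move=> n; exact: iter_drift_bound. Qed.

Lemma flow0 i : flow f 0 i = f i.
Proof. exact: (egf0 (growth i)). Qed.

Lemma flow_bound t T i : 0 <= t <= T -> `|flow f t i| <= A * expR (2 * K * T).
Proof.
move=> /andP[t0 tT]; rewrite (le_trans (egf_bound (growth i) t))//.
have A0 : 0 <= A by exact: le_trans (fA i).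
by rewrite ler_wpM2l// ler_expR ger0_norm// ler_wpM2l// mulr_ge0.
Qed.

Lemma flow_is_derive t i :
  is_derive t (1 : R) (fun t => flow f t i) (drift_app (flow f t) i).
Proof.
have := egf_is_derive t (growth i); congr is_derive.
have h : has_sum (fun n => \sum_j drift i j * (iter n drift_app f j / n`!%:R * t ^+ n))
    (drift_app (flow f t) i).
  by apply: has_sum_sum => j _; apply: has_sumZ; exact: egf_has_sum (growth j) t.
apply: (has_sum_unique (egf_has_sum (shift_growth (growth i)) t)).
apply: eq_has_sum h => n; rewrite /= {2}/drift_app !mulr_suml.
by apply: eq_bigr => j _; rewrite !mulrA.
Qed.

End Flow.

(** The right-hand side at time [T] is the supersolution [v]. The exponential rate
    [L] absorbs the carre du champ of [flow], which is bounded by [G] up to time [T],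
    together with the growth of the mass; the summand [1 + t] makes the inequality
    strict at the empty configuration. *)
Lemma second_moment_bound (p : R -> conf -> conf -> R) (f : 'I_N -> R)
    (A c T M : R) (W : conf -> R) x :
  transition_function p -> has_generator lambda psi p ->
  (forall i, `|f i| <= A) -> 0 <= T ->
  (forall y, 0 <= W y) -> (forall y, W y <= M) ->
  (forall y, W y <= (lin f y - c) ^+ 2) ->
  (semigroup p T W x <= ((lin (flow f T) x - c) ^+ 2
    + expR (2 * K * ((A * expR (2 * K * T)) ^+ 2 + 1) * T) * mass x
    + (1 + T))%:E)%E.
Proof.
move=> tp gen fA T0 W0 WM Wf.
set G := A * expR (2 * K * T); set L := 2 * K * (G ^+ 2 + 1).
have L0 : 0 <= L by rewrite mulr_ge0 ?mulr_ge0// addr_ge0// sqr_ge0.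
pose v t y := (lin (flow f t) y - c) ^+ 2 + expR (L * t) * mass y + (1 + t).
pose dv t y := 2 * (lin (flow f t) y - c) * lin (drift_app (flow f t)) y
  + L * expR (L * t) * mass y + 1.
have M0 : 0 <= M by exact: le_trans (W0 x) (WM x).
have [s [us sn]] := finite_configs (Num.bound M).
have e1 t : 0 <= t -> 1 <= expR (L * t).
  by move=> t0; rewrite -expR0 ler_expR mulr_ge0.
have vM t y : 0 <= t <= T -> y \notin s -> M <= v t y.
  move=> /andP[t0 _] ys; have h1 := sn _ ys; have h2 := archi_boundP M0.
  have h3 : mass y <= expR (L * t) * mass y by rewrite ler_peMl ?mass_ge0 ?e1.
  by have := sqr_ge0 (lin (flow f t) y - c); rewrite /v; lra.
have vd t y : is_derive (t : R) (1 : R) (v ^~ y : R -> R) (dv t y).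
  have dl : is_derive t (1 : R) (fun t => lin (flow f t) y - c)
      (lin (drift_app (flow f t)) y - 0).
    apply: is_derive_funB.
    by apply: is_derive_funsum => i; apply: is_derive_funZ; exact: flow_is_derive fA _ _.
  have de : is_derive t (1 : R) (fun t => expR (L * t)) (L * expR (L * t)).
    have h : is_derive t (1 : R) (fun t => L * t) (L * 1).
      by apply: is_derive_funZ; exact: is_derive_id.
    by have := is_derive1_comp (is_derive_expR (L * t)) h; rewrite mulr1 mulrC.
  have d1 : is_derive t (1 : R) (fun t => 1 + t) (0 + 1).
    exact: (is_derive_funD (is_derive_cst (1 : R) t (1 : R)) (is_derive_id t (1 : R))).
  have := is_derive_funD (is_derive_funD (is_derive_funM dl dl)
    (is_derive_funM de (is_derive_cst (mass y) t (1 : R)))) d1.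
  rewrite (_ : _ + (0 + 1) = dv t y); last by rewrite /dv /cst /=; ring.
  by congr is_derive.
apply: (comparison tp gen us W0 WM _ vd vM).
- move=> y; rewrite /v.
  have h1 := Wf y; have h2 := mass_ge0 y.
  rewrite mulr0 expR0 mul1r addr0.
  have -> : lin (flow f 0) y = lin f y.
    by apply: eq_bigr => i _; rewrite (flow0 fA).
  lra.
- move=> t y t0T ys v0 vyM.
  have gG j : `|flow f t j| <= G by exact: flow_bound.
  have a0 : 0 <= expR (L * t) by exact: expR_ge0.
  have [hV leV] := generator_quadratic c (1 + t) y gG a0.
  have vMt z : z \notin s -> M <= v t z by exact: vM.
  apply: lt_le_trans (generator_truncated us vMt vyM hV).
  rewrite ltrN2; apply: le_lt_trans leV _; rewrite /dv -addrA ltrD2l.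
  apply: (@le_lt_trans _ _ (L * expR (L * t) * mass y)); last by rewrite ltrDl.
  rewrite ler_wpM2r ?mass_ge0// /L.
  have h1 : 1 <= expR (L * t) by apply: e1; case/andP: t0T.
  rewrite -[leRHS]mulrA [leRHS]mulrC ler_wpM2r ?mulr_ge0//.
  by have := sqr_ge0 G; rewrite -/L; nra.
- by rewrite T0 lexx.
Qed.

End UrnGenerator.

(** * Expectations of functions of discrete random variables *)

Section Mean.
Variables (R : realType) (d : measure_display) (Omega : measurableType d).
Variable P : probability Omega R.
Implicit Types (F G : Omega -> R) (e : R).

Definition has_mean F e :=
  P.-integrable setT (EFin \o F) /\ (\int[P]_w (F w)%:E = e%:E)%E.

Lemma eq_has_mean F G e : F =1 G -> has_mean F e -> has_mean G e.
Proof. by move=> /funext ->. Qed.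

Lemma has_mean_cst e : has_mean (fun=> e) e.
Proof.
split; first exact: finite_measure_integrable_cst.
have -> : (\int[P]_w e%:E = e%:E * P setT)%E by exact: (integral_cst P measurableT).
by rewrite probability_setT mule1.
Qed.

Lemma has_meanD F G e e' : has_mean F e -> has_mean G e' ->
  has_mean (fun w => F w + G w) (e + e').
Proof.
move=> [iF eF] [iG eG]; split; first exact: (integrableD measurableT iF iG).
by have := integralD measurableT iF iG; rewrite /= eF eG; apply.
Qed.

Lemma has_meanZ c F e : has_mean F e -> has_mean (fun w => c * F w) (c * e).
Proof.
move=> [iF eF]; split; first exact: (integrableZl measurableT c iF).
by have := integralZl measurableT iF c; rewrite /= eF; apply.
Qed.

Lemma has_mean_sum n (F : 'I_n -> Omega -> R) (e : 'I_n -> R) :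
  (forall i, has_mean (F i) (e i)) ->
  has_mean (fun w => \sum_i F i w) (\sum_i e i).
Proof.
move=> h; elim: (index_enum _) => [|i s IH].
  by rewrite big_nil; apply: eq_has_mean (has_mean_cst 0) => w; rewrite big_nil.
rewrite big_cons; apply: eq_has_mean (has_meanD (h i) IH) => w.
by rewrite big_cons.
Qed.

End Mean.

Section DiscreteLaw.
Variables (R : realType) (d : measure_display) (Omega : measurableType d).
Variable P : probability Omega R.
Variables (S : countType) (Y : Omega -> S).
Hypothesis mY : forall y, measurable (Y @^-1` [set y]).

Lemma discrete_preimage (B : set S) : measurable (Y @^-1` B).
Proof.
pose A k := Y @^-1` [set y | pickle y = k /\ B y].
have -> : Y @^-1` B = \bigcup_k A k.
  by apply/seteqP; split => [w Bw|w [k _ []]//]; exists (pickle (Y w)).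
apply: bigcupT_measurable => k.
have [[y [<- By]]|no] := pselect (exists y, pickle y = k /\ B y).
  rewrite (_ : A _ = Y @^-1` [set y])//; apply/seteqP; split => [w|w].
    by move=> [/(pcan_inj pickleK)].
  by rewrite /A/= => ->.
rewrite (_ : A k = set0)//; apply/seteqP; split => // w Aw.
by apply: no; exists (Y w).
Qed.

Lemma measurable_fun_discrete (F : S -> R) :
  measurable_fun setT (fun w => (F (Y w))%:E).
Proof. by move=> _ B _; rewrite setTI; exact: (discrete_preimage [set y | B (F y)%:E]). Qed.

(** The level sets of [pickle \o Y] form a countable measurable partition on which
    the integrand is constant. *)
Lemma discrete_integral (F : S -> R) : (forall y, 0 <= F y) ->
  (\int[P]_w (F (Y w))%:E =
   \esum_(y in [set: S]) (P (Y @^-1` [set y]) * (F y)%:E))%E.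
Proof.
move=> F0; pose A k := Y @^-1` [set y | pickle y = k].
have AT : \bigcup_k A k = setT.
  by apply/seteqP; split => // w _; exists (pickle (Y w)).
have tA : trivIset setT A.
  by move=> i j _ _ [w [Ai Aj]]; rewrite -Ai -Aj.
rewrite -AT ge0_integral_bigcup//; first last.
- by move=> w _; rewrite lee_fin.
- by rewrite AT; exact: measurable_fun_discrete.
- by move=> k; exact: discrete_preimage.
rewrite nneseries_esumT; last first.
  by move=> k; apply: integral_ge0 => w _; rewrite lee_fin.
have inj : set_inj [set: S] (@pickle S).
  by move=> y z _ _; exact: (pcan_inj pickleK).
transitivity (\esum_(k in pickle @` [set: S]) \int[P]_(w in A k) (F (Y w))%:E)%E.
  rewrite [RHS]esum_mkcond; apply: eq_esum => k _; case: ifPn => // /negP kS.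
  rewrite (_ : A k = set0) ?integral_set0//; apply/seteqP; split => // w Aw.
  by apply: kS; rewrite inE; exists (Y w).
rewrite esum_image//; apply: eq_esum => y _.
rewrite (_ : A (pickle y) = Y @^-1` [set y]); last first.
  by apply/seteqP; split => [w /(pcan_inj pickleK)//|w /= <-].
rewrite muleC -[RHS](integral_cst P (mY y)).
by apply: eq_integral => w /set_mem/= ->.
Qed.

Lemma discrete_has_mean (F : S -> R) (e : R) : (forall y, 0 <= F y) ->
  (\esum_(y in [set: S]) (P (Y @^-1` [set y]) * (F y)%:E) = e%:E)%E ->
  has_mean P (fun w => F (Y w)) e.
Proof.
move=> F0 h; have hi := discrete_integral F0; rewrite h in hi; split=> //.
apply/integrableP; split.
  exact: measurable_fun_discrete.
under eq_integral => w _ do rewrite /= ger0_norm//.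
by rewrite hi ltry.
Qed.

End DiscreteLaw.

Section Poisson.
Variable R : realType.
Implicit Types (r : R).

(** Unlike the probability mass function [poisson_pmf], which takes the value 1 for
    a nonpositive parameter, this is also the law for [r = 0], since [0 ^+ 0 = 1]. *)
Definition poisson_weight r (k : nat) : R := k`!%:R^-1 * r ^+ k * expR (- r).

Lemma poisson_weight_ge0 r k : 0 <= r -> 0 <= poisson_weight r k.
Proof. by move=> r0; rewrite !mulr_ge0 ?exprn_ge0// expR_ge0. Qed.

Lemma poisson_prob_set1 r k : 0 <= r ->
  poisson_prob r 0 [set k] = (poisson_weight r k)%:E.
Proof.
move=> r0; rewrite /poisson_prob; case: ifPn => [rpos|].
  rewrite esum_set1 ?lee_fin ?poisson_pmf_ge0// /poisson_pmf rpos.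
  by rewrite /poisson_weight [_%:R^-1 * _]mulrC.
rewrite -leNgt => rle; have -> : r = 0 by apply/eqP; rewrite eq_le rle.
rewrite /poisson_weight oppr0 expR0 mulr1 diracE expr0n.
case: eqVneq => [->|k0].
  by rewrite mem_set//= fact0 invr1 mulr1.
by rewrite memNset ?mulr0//= => k00; rewrite -k00 eqxx in k0.
Qed.

Lemma has_sum_shift (u : nat -> R) l : u 0%N = 0 ->
  has_sum (fun k => u k.+1) l -> has_sum u l.
Proof.
move=> u0 h; rewrite /has_sum -cvg_shiftS; apply: cvg_trans h.
by apply: near_eq_cvg; near=> n; rewrite /= [RHS]big_nat_recl// u0 add0r.
Unshelve. all: by end_near. Qed.

Lemma poisson_mass r : has_sum (poisson_weight r) 1.
Proof.
have := has_sumZ (expR (- r)) (has_sum_expR r).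
rewrite -expRD addNr expR0; apply: eq_has_sum => k.
by rewrite /poisson_weight mulrC.
Qed.

Let weightS r k : k.+1%:R * poisson_weight r k.+1 = r * poisson_weight r k.
Proof.
rewrite /poisson_weight factS natrM invfM exprS.
have k0 : k.+1%:R != 0 :> R by rewrite pnatr_eq0.
rewrite -!mulrA mulVKf//; ring.
Qed.

Lemma poisson_mean r : has_sum (fun k => k%:R * poisson_weight r k) r.
Proof.
apply: has_sum_shift; first by rewrite mul0r.
have := has_sumZ r (@poisson_mass r); rewrite mulr1.
by apply: eq_has_sum => k; rewrite weightS.
Qed.

Lemma poisson_moment2 r :
  has_sum (fun k => k%:R ^+ 2 * poisson_weight r k) (r ^+ 2 + r).
Proof.
apply: has_sum_shift; first by rewrite expr0n mul0r.
have := has_sumZ r (has_sumD (@poisson_mean r) (@poisson_mass r)).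
rewrite mulrDr mulr1 -expr2; apply: eq_has_sum => k.
rewrite expr2 -mulrA weightS -[k.+1]addn1 natrD; ring.
Qed.

End Poisson.

(** * Second moment of the urn process at a fixed time *)

Lemma esum_has_sum (R : realType) (u : nat -> R) (l : R) :
  (forall k, 0 <= u k) -> has_sum u l ->
  (\esum_(k in [set: nat]) (u k)%:E = l%:E)%E.
Proof.
move=> u0 h; rewrite -nneseries_esumT; last by move=> k; rewrite lee_fin.
rewrite -(has_sum_lim h) -EFin_lim; last exact: cvgP h.
by apply/congr_lim/funext => n /=; rewrite sumEFin.
Qed.

Lemma esum_pair (R : realType) (T U : choiceType) (a : T -> U -> \bar R) :
  (forall x y, (0 <= a x y)%E) ->
  (\esum_(z in [set: T * U]) a z.1 z.2 =
   \esum_(x in [set: T]) \esum_(y in [set: U]) a x y)%E.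
Proof.
move=> a0; rewrite esum_esum//; congr esum.
by apply/seteqP; split => // z _; split.
Qed.

Section UrnLaw.
Variables (R : realType) (N : nat).
Variables (d : measure_display) (Omega : measurableType d).
Variable P : probability Omega R.

Section InitialLaw.
Variables (phi : R -> R) (Y : Omega -> config N).
Hypothesis phi0 : forall u, 0 <= phi u.
Hypothesis mY : forall x, measurable (Y @^-1` [set x]).
Hypothesis poissonY : independent_poisson P phi Y.

Local Notation m i := (phi (urn_pos R i)).

Let mYi i (a : nat) : measurable ((fun w => Y w i) @^-1` [set a]).
Proof. exact: (discrete_preimage mY [set x | x i = a]). Qed.

Let lawYi i a : P ((fun w => Y w i) @^-1` [set a]) = (poisson_weight (m i) a)%:E.
Proof. by rewrite -poisson_prob_set1//; case: poissonY => _ /(_ i [set a]). Qed.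

Lemma initial_mean i : has_mean P (fun w => (Y w i)%:R) (m i).
Proof.
apply: (discrete_has_mean (mYi i) (F := fun a => a%:R)) => //.
under eq_esum => a _ do rewrite lawYi -EFinM mulrC.
apply: esum_has_sum; last exact: poisson_mean.
by move=> k; rewrite mulr_ge0// poisson_weight_ge0.
Qed.

Lemma initial_moment2 i :
  has_mean P (fun w => (Y w i)%:R * (Y w i)%:R) (m i * m i + m i).
Proof.
apply: (discrete_has_mean (mYi i) (F := fun a => a%:R * a%:R)) => //.
under eq_esum => a _ do rewrite lawYi -EFinM mulrC -expr2.
rewrite -expr2; apply: esum_has_sum; last exact: poisson_moment2.
by move=> k; rewrite mulr_ge0 ?sqr_ge0// poisson_weight_ge0.
Qed.

Lemma initial_correlation i j : i != j ->
  has_mean P (fun w => (Y w i)%:R * (Y w j)%:R) (m i * m j).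
Proof.
move=> ij.
have mZ (z : nat * nat) : measurable ((fun w => (Y w i, Y w j)) @^-1` [set z]).
  exact: (discrete_preimage mY [set x | (x i, x j) = z]).
have lawZ (z : nat * nat) : P ((fun w => (Y w i, Y w j)) @^-1` [set z]) =
    (poisson_weight (m i) z.1 * poisson_weight (m j) z.2)%:E.
  case: z => a b /=.
  have := poissonY.1 [set i; j]%SET
    (fun l => if l == i then [set a] else [set b]).
  rewrite big_setU1/=; last by rewrite finset.inE.
  rewrite big_set1 eqxx [j == i]eq_sym (negbTE ij).
  rewrite -/((fun w => Y w i) @^-1` [set a]) -/((fun w => Y w j) @^-1` [set b]).
  rewrite !lawYi -EFinM => <-; congr (P _); apply/seteqP; split => w /=.
    move=> [ai bj] l; rewrite !finset.inE => /orP[]/eqP ->; rewrite ?eqxx//.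
    by rewrite [j == i]eq_sym (negbTE ij).
  move=> h; have hi := h i; have hj := h j.
  rewrite !finset.inE eqxx in hi; rewrite !finset.inE eqxx orbT [j == i]eq_sym (negbTE ij) in hj.
  by rewrite hi// hj.
apply: (discrete_has_mean mZ (F := fun z => z.1%:R * z.2%:R)) => //.
pose u k := k%:R * poisson_weight (m i) k; pose v k := k%:R * poisson_weight (m j) k.
have u0 k : 0 <= u k by rewrite mulr_ge0// poisson_weight_ge0.
have v0 k : 0 <= v k by rewrite mulr_ge0// poisson_weight_ge0.
transitivity (\esum_(z in [set: nat * nat]) ((u z.1)%:E * (v z.2)%:E))%E.
  by apply: eq_esum => z _; rewrite lawZ -!EFinM /u /v; congr EFin; ring.
rewrite (@esum_pair _ _ _ (fun a b => (u a)%:E * (v b)%:E)%E); last first.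
  by move=> a b; rewrite -EFinM lee_fin mulr_ge0.
under eq_esum => a _.
  rewrite esumZl//.
  rewrite (esum_has_sum v0 (@poisson_mean R (m j))) -EFinM mulrC; over.
apply: esum_has_sum => [k|]; first by rewrite mulr_ge0.
by rewrite mulrC; apply: has_sumZ; exact: poisson_mean.
Qed.

(** The covariance of the initial numbers is diagonal, with the means on the
    diagonal, so the variance is a single sum over the urns. *)
Lemma initial_quadratic (g : 'I_N -> R) (c : R) :
  has_mean P (fun w => (lin g (Y w) - c) ^+ 2)
    ((\sum_i m i * g i - c) ^+ 2 + \sum_i m i * g i ^+ 2).
Proof.
have hij i j : has_mean P (fun w => (Y w i)%:R * (Y w j)%:R)
    (m i * m j + (j == i)%:R * m i).
  case: eqVneq => [->|ji]; first by rewrite mul1r; exact: initial_moment2.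
  by rewrite mul0r addr0; apply: initial_correlation; rewrite eq_sym.
have h1 : has_mean P (fun w => \sum_i \sum_j g i * g j * ((Y w i)%:R * (Y w j)%:R))
    (\sum_i \sum_j g i * g j * (m i * m j + (j == i)%:R * m i)).
  by apply: has_mean_sum => i; apply: has_mean_sum => j; exact: has_meanZ.
have h2 : has_mean P (fun w => - (2 * c) * \sum_i g i * (Y w i)%:R)
    (- (2 * c) * \sum_i g i * m i).
  apply: has_meanZ; apply: has_mean_sum => i; apply: has_meanZ.
  exact: initial_mean.
have sq (a : 'I_N -> R) : (\sum_i a i * g i) * (\sum_i a i * g i) =
    \sum_i \sum_j g i * g j * (a i * a j).
  rewrite mulr_suml; apply: eq_bigr => i _; rewrite mulr_sumr.
  by apply: eq_bigr => j _; ring.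
have := has_meanD (has_meanD h1 h2) (has_mean_cst P (c ^+ 2)).
have -> : \sum_i \sum_j g i * g j * (m i * m j + (j == i)%:R * m i) =
    (\sum_i m i * g i) * (\sum_i m i * g i) + \sum_i m i * g i ^+ 2.
  rewrite sq -big_split/=; apply: eq_bigr => i _.
  rewrite (_ : _ * _ ^+ 2 = g i * g i * m i); last by ring.
  have /= <- := sum_delta (fun j => g i * g j * m i) i.
  by rewrite -big_split/=; apply: eq_bigr => j _; ring.
have cm (a : 'I_N -> R) : \sum_i g i * a i = \sum_i a i * g i.
  by apply: eq_bigr => i _; rewrite mulrC.
rewrite cm => h.
rewrite [X in has_mean _ _ X](_ : _ = (\sum_i m i * g i) * (\sum_i m i * g i)
  + \sum_i m i * g i ^+ 2 + - (2 * c) * (\sum_i m i * g i) + c ^+ 2); last by ring.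
by apply: eq_has_mean h => w; rewrite cm -(sq (fun i => (Y w i)%:R)) /lin; ring.
Qed.

End InitialLaw.

Variables (X : R -> Omega -> config N) (p : R -> config N -> config N -> R).
Hypothesis mX : forall t x, 0 <= t -> measurable (X t @^-1` [set x]).
Hypothesis tp : transition_function p.
Hypothesis markov : markov_process P X p.

(** Applied at the initial time with the sure event, the Markov property gives
    the joint law of the initial and the current configuration. *)
Lemma markov_expectation (T : R) (F v : config N -> R) : 0 <= T ->
  (forall y, 0 <= F y) -> (forall y, 0 <= v y) ->
  (forall x, (semigroup p T F x <= (v x)%:E)%E) ->
  (\int[P]_w (F (X T w))%:E <= \int[P]_w (v (X 0 w))%:E)%E.
Proof.
move=> T0 F0 v0 Fv.
have mX0 := fun x => mX x (lexx 0).
have p0 x y : 0 <= p T x y by case: tp => + _ _ _; apply.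
have mZ (z : config N * config N) :
    measurable ((fun w => (X 0 w, X T w)) @^-1` [set z]).
  rewrite (_ : _ @^-1` _ = X 0 @^-1` [set z.1] `&` X T @^-1` [set z.2]).
    by apply: measurableI; exact: mX.
  by apply/seteqP; split => w /=; [move=> <-|move=> [-> ->]; case: z].
have joint x y : P ((fun w => (X 0 w, X T w)) @^-1` [set (x, y)]) =
    (P (X 0 @^-1` [set x]) * (p T x y)%:E)%E.
  have pT : past X 0 setT.
    have : past X 0 ([set: Omega] `\` set0).
      by apply: sigma_algebraCD; exact: sigma_algebra0.
    by rewrite setD0.
  have := markov (s := 0) (t := T) x y (lexx 0) T0 pT.
  rewrite setTI add0r => <-; congr (P _).
  by apply/seteqP; split => w /=; [move=> [-> ->]|move=> [-> ->]].
rewrite (discrete_integral P mZ (F := fun z => F z.2))//.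
rewrite (discrete_integral P mX0)//.
have P0 x : (P (X 0 @^-1` [set x]) = (fine (P (X 0 @^-1` [set x])))%:E)%E.
  by rewrite fineK// fin_num_measure.
rewrite (@eq_esum _ _ _ _ (fun z : config N * config N =>
    P (X 0 @^-1` [set z.1]) * (p T z.1 z.2 * F z.2)%:E)%E); last first.
  by move=> [x y] _; rewrite joint -muleA -EFinM.
rewrite (@esum_pair _ _ _ (fun x y => P (X 0 @^-1` [set x]) * (p T x y * F y)%:E)%E).
  apply: le_esum => x _; rewrite P0 esumZl//.
  - by apply: lee_wpmul2l; rewrite ?lee_fin ?fine_ge0//; exact: Fv.
  - by rewrite fine_ge0.
  - by move=> y; rewrite lee_fin mulr_ge0.
by move=> x y; rewrite mule_ge0// lee_fin mulr_ge0.
Qed.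

(** Sums over all configurations are suprema of sums over finite sets, and on a
    finite set [F] may be replaced by a bounded function. *)
Lemma semigroup_le_bounded (T : R) (F v : config N -> R) : 0 <= T ->
  (forall y, 0 <= F y) ->
  (forall (W : config N -> R) M x, (forall y, 0 <= W y) -> (forall y, W y <= M) ->
    (forall y, W y <= F y) -> (semigroup p T W x <= (v x)%:E)%E) ->
  forall x, (semigroup p T F x <= (v x)%:E)%E.
Proof.
move=> T0 F0 h x; apply: ge_ereal_sup => _ [A [finA _] <-].
have p0 y : 0 <= p T x y by case: tp => + _ _ _; apply.
pose W y := if y \in A then F y else 0.
have W0 y : 0 <= W y by rewrite /W; case: ifP.
apply: (@le_trans _ _ (semigroup p T W x)).
  apply: esum_ge; exists A => //; rewrite le_eqVlt; apply/orP; left; apply/eqP.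
  by apply: eq_fsbigr => y yA; rewrite /W yA.
apply: (h W (\sum_(y \in A) F y)) => // y; rewrite /W; case: ifPn => // yA.
- rewrite (fsbigD1 y)//=; last by rewrite inE in yA.
  by rewrite lerDl; apply: sumr_ge0.
- by apply: sumr_ge0.
Qed.

End UrnLaw.

Section UrnSecondMoment.
Variables (R : realType) (lambda : nat -> R * R -> R) (psi : nat -> R -> R).
Variable K : R.
Hypothesis reg : regular_rates lambda psi K.
Variables (N : nat) (phi : R -> R).
Hypotheses (N0 : (0 < N)%N) (phi0 : forall u, 0 <= phi u).
Variables (d : measure_display) (Omega : measurableType d).
Variables (P : probability Omega R) (X : R -> Omega -> config N).
Hypothesis urnX : urn_branching_process lambda psi P X.
Hypothesis poissonX : independent_poisson P phi (X 0).

Lemma urn_second_moment (f : 'I_N -> R) (A c T : R) :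
  (forall i, `|f i| <= A) -> 0 <= T ->
  (\int[P]_w ((lin f (X T w) - c) ^+ 2)%:E <=
    ((\sum_(i < N) phi (urn_pos R i) * flow lambda psi f T i - c) ^+ 2
     + \sum_(i < N) phi (urn_pos R i) * flow lambda psi f T i ^+ 2
     + expR (2 * K * ((A * expR (2 * K * T)) ^+ 2 + 1) * T)
       * \sum_(i < N) phi (urn_pos R i) + (1 + T))%:E)%E.
Proof.
move=> fA T0; pose g := flow lambda psi f T.
have [mX [p [tp gen markov]]] := urnX.
pose E := expR (2 * K * ((A * expR (2 * K * T)) ^+ 2 + 1) * T).
pose v x := (lin g x - c) ^+ 2 + E * mass R x + (1 + T).
have v0 x : 0 <= v x.
  by rewrite !addr_ge0 ?sqr_ge0 ?mulr_ge0 ?mass_ge0 ?expR_ge0.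
have mX0 x := mX 0 x (lexx 0).
have mean_v : has_mean P (fun w => v (X 0 w)) ((\sum_(i < N) phi (urn_pos R i) * g i - c) ^+ 2
     + \sum_(i < N) phi (urn_pos R i) * g i ^+ 2
     + E * \sum_(i < N) phi (urn_pos R i) + (1 + T)).
  apply: has_meanD (has_mean_cst P (1 + T)); apply: has_meanD.
    exact: (initial_quadratic phi0 mX0 poissonX).
  by apply: has_meanZ; apply: has_mean_sum => i; exact: (initial_mean phi0 mX0 poissonX).
rewrite -(mean_v.2).
apply: (markov_expectation mX tp markov (F := fun y => (lin f y - c) ^+ 2)) => //.
  by move=> y; exact: sqr_ge0.
apply: (semigroup_le_bounded tp) => //; first by move=> y; exact: sqr_ge0.
move=> W M x W0 WM WF.
exact: (second_moment_bound reg N0 x tp gen fA T0 W0 WM WF).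
Qed.

End UrnSecondMoment.

(** * From the urns to the torus *)

Section Discretisation.
Variables (R : realType) (lambda : nat -> R * R -> R) (psi : nat -> R -> R).
Variable K : R.
Hypothesis reg : regular_rates lambda psi K.

Let K0 : 0 <= K := rates_bound_ge0 reg.

Local Notation pos := (urn_pos R).
Local Notation mr := (mean_rate lambda).
Local Notation tr := (total_rate lambda).

Lemma average_bound N (a : 'I_N -> R) (C : R) : 0 <= C -> (forall i, `|a i| <= C) ->
  `|N%:R^-1 * \sum_i a i| <= C.
Proof.
move=> C0 aC; case: N a aC => [|N] a aC; first by rewrite big_ord0 mulr0 normr0.
rewrite normrM normfV normr_nat ler_pdivrMl ?ltr0n//.
rewrite (le_trans (ler_norm_sum _ _ _))//.
apply: (le_trans (ler_sum _ (fun i _ => aC i))).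
by rewrite sumr_const card_ord mulr_natl.
Qed.

Lemma urn_pos_itv N (i : 'I_N) : 0 <= pos i <= 1.
Proof.
have N0 : (0 < N)%N by exact: leq_ltn_trans (leq0n i) (ltn_ord i).
by rewrite divr_ge0//= ler_pdivrMr ?ltr0n// mul1r ler_nat.
Qed.

Section Grid.
Variable N : nat.
Hypothesis N0 : (0 < N)%N.

(** The transpose of the drift acts on densities. *)
Definition adjoint (r : 'I_N -> R) (j : 'I_N) : R :=
  \sum_i r i * drift lambda psi i j.

Lemma adjointE (r : 'I_N -> R) j : adjoint r j =
  N%:R^-1 * \sum_i mr (pos i, pos j) * r i - N%:R^-1 * (mr (pos j, pos j) * r j)
  + r j * growth_rate psi (pos j)
  - (r j * (N%:R^-1 * \sum_(l < N) tr (pos j, pos l)) - N%:R^-1 * (r j * tr (pos j, pos j))).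
Proof.
have diag (i : 'I_N) : urn_mean lambda psi i i - urn_total lambda psi i i = growth_rate psi (pos i).
  have h1 := @urn_mean_has_sum _ _ _ _ reg N i i.
  have h2 := @urn_total_has_sum _ _ _ _ reg N i i.
  apply: (has_sum_unique (has_sumB h1 h2)).
  apply: eq_has_sum (growth_rate_spec reg (pos i)).1 => k.
  by rewrite /urn_rate eqxx mulrBl mul1r.
have offm (i l : 'I_N) : l != i -> urn_mean lambda psi i l = N%:R^-1 * mr (pos i, pos l).
  move=> li; apply: (has_sum_unique (@urn_mean_has_sum _ _ _ _ reg N i l)).
  apply: eq_has_sum (has_sumZ N%:R^-1 (mean_rate_spec reg (pos i, pos l)).1) => k.
  by rewrite /urn_rate (negbTE li) mulrCA.
have offt (i l : 'I_N) : l != i -> urn_total lambda psi i l = N%:R^-1 * tr (pos i, pos l).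
  move=> li; apply: (has_sum_unique (@urn_total_has_sum _ _ _ _ reg N i l)).
  apply: eq_has_sum (has_sumZ N%:R^-1 (total_rate_spec reg (pos i, pos l)).1) => k.
  by rewrite /urn_rate (negbTE li).
have e1 : \sum_i r i * urn_mean lambda psi i j =
    N%:R^-1 * \sum_i mr (pos i, pos j) * r i - N%:R^-1 * (mr (pos j, pos j) * r j)
    + r j * urn_mean lambda psi j j.
  rewrite (bigD1 j)//= [in RHS](bigD1 j)//= mulrDr.
  rewrite (eq_bigr (fun i => N%:R^-1 * (mr (pos i, pos j) * r i))); last first.
    by move=> i ij; rewrite offm 1?eq_sym//; ring.
  by rewrite -mulr_sumr; ring.
have e2 : \sum_l urn_total lambda psi j l =
    N%:R^-1 * \sum_(l < N) tr (pos j, pos l) - N%:R^-1 * tr (pos j, pos j)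
    + urn_total lambda psi j j.
  rewrite (bigD1 j)//= [in RHS](bigD1 j)//= mulrDr.
  rewrite (eq_bigr (fun l => N%:R^-1 * tr (pos j, pos l))); last first.
    by move=> l lj; rewrite offt.
  by rewrite -mulr_sumr; ring.
rewrite /adjoint /drift; under eq_bigr do rewrite mulrBr.
rewrite sumrB e1.
have -> : \sum_i r i * ((j == i)%:R * \sum_l urn_total lambda psi i l) =
    r j * \sum_l urn_total lambda psi j l.
  have /= <- := sum_delta (fun i => r i * \sum_l urn_total lambda psi i l) j.
  by apply: eq_bigr => i _; rewrite mulrCA eq_sym.
by rewrite e2 -(diag j); ring.
Qed.

Let invN1 : N%:R^-1 <= 1 :> R.
Proof. by rewrite invf_le1 ?ler1n ?ltr0n. Qed.

Let scaled (a C : R) : 0 <= C -> `|a| <= C -> `|N%:R^-1 * a| <= N%:R^-1 * C.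
Proof. by move=> C0 aC; rewrite normrM normfV normr_nat ler_wpM2l. Qed.

Let product (a b B : R) : `|a| <= B -> `|b| <= K -> `|a * b| <= B * K.
Proof. by move=> aB bK; rewrite normrM ler_pM. Qed.

Lemma adjoint_bound (r : 'I_N -> R) (B : R) : (forall i, `|r i| <= B) -> forall j, `|adjoint r j| <= B * (5 * K).
Proof.
move=> rB j; have B0 : 0 <= B by exact: le_trans (rB j).
have BK0 : 0 <= B * K by rewrite mulr_ge0.
have trK z : `|tr z| <= K by case: (total_rate_spec reg z).
have mrK z : `|mr z| <= K by case: (mean_rate_spec reg z).
have b1 : `|N%:R^-1 * \sum_i mr (pos i, pos j) * r i| <= B * K.
  by apply: average_bound => // i; rewrite mulrC; exact: product.
have b2 : `|N%:R^-1 * (mr (pos j, pos j) * r j)| <= B * K.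
  apply: le_trans (scaled BK0 _) _; first by rewrite mulrC; exact: product.
  by rewrite -[leRHS]mul1r ler_wpM2r.
have b3 : `|r j * growth_rate psi (pos j)| <= B * K.
  by apply: product => //; case: (growth_rate_spec reg (pos j)).
have b4 : `|r j * (N%:R^-1 * \sum_(l < N) tr (pos j, pos l))| <= B * K.
  by apply: product => //; exact: average_bound.
have b5 : `|N%:R^-1 * (r j * tr (pos j, pos j))| <= B * K.
  apply: le_trans (scaled BK0 _) _; first exact: product.
  by rewrite -[leRHS]mul1r ler_wpM2r.
rewrite adjointE (le_trans (ler_normB _ _))//.
have := ler_normB (r j * (N%:R^-1 * \sum_(l < N) tr (pos j, pos l)))
  (N%:R^-1 * (r j * tr (pos j, pos j))).
have := ler_normD (N%:R^-1 * \sum_i mr (pos i, pos j) * r i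
  - N%:R^-1 * (mr (pos j, pos j) * r j)) (r j * growth_rate psi (pos j)).
have := ler_normB (N%:R^-1 * \sum_i mr (pos i, pos j) * r i)
  (N%:R^-1 * (mr (pos j, pos j) * r j)).
lra.
Qed.

Lemma adjointB (r r' : 'I_N -> R) j : adjoint r j - adjoint r' j = adjoint (fun i => r i - r' i) j.
Proof. by rewrite /adjoint -sumrB; apply: eq_bigr => i _; rewrite mulrBl. Qed.

Lemma adjoint_pairing n (r g : 'I_N -> R) :
  \sum_i r i * iter n (@drift_app R lambda psi N) g i = \sum_j iter n adjoint r j * g j.
Proof.
elim: n g => // n IH g; rewrite iterSr IH /drift_app.
under eq_bigr do rewrite mulr_sumr.
rewrite exchange_big; apply: eq_bigr => l _ /=; rewrite /adjoint mulr_suml.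
by apply: eq_bigr => j _; rewrite mulrA.
Qed.

(** The terms [j = i] are left out of the Riemann sums at a cost of order
    [1 / N]. *)
Lemma adjoint_P2_dist (g : R -> R) (B e : R) j : (forall u, `|g u| <= B) -> 0 <= e ->
  `|N%:R^-1 * \sum_(i < N) transport lambda g (pos j, pos i)
    - torus_int (fun v => transport lambda g (pos j, v))| <= e ->
  `|N%:R^-1 * \sum_(i < N) tr (pos j, pos i) - torus_int (fun v => tr (pos j, v))| <= e ->
  `|adjoint (fun i => g (pos i)) j - P2 lambda psi g (pos j)|
    <= (1 + B) * e + 2 * (B * K) * N%:R^-1.
Proof.
move=> gB e0 h1 h2; rewrite adjointE P2E.
have B0 : 0 <= B by exact: le_trans (gB 0).
have BK0 : 0 <= B * K by rewrite mulr_ge0.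
set S1 := N%:R^-1 * _ in h1; set I1 := torus_int _ in h1.
set S2 := N%:R^-1 * _ in h2; set I2 := torus_int _ in h2.
have -> : N%:R^-1 * \sum_(i < N) mr (pos i, pos j) * g (pos i) = S1 by [].
have -> : N%:R^-1 * \sum_(l < N) tr (pos j, pos l) = S2 by [].
have -> : torus_int (fun v => tr (pos j, v)) = I2 by [].
have -> : torus_int (fun v => mr (v, pos j) * g v) = I1 by [].
have b1 : `|N%:R^-1 * (mr (pos j, pos j) * g (pos j))| <= N%:R^-1 * (B * K).
  apply: scaled => //; rewrite mulrC; apply: product => //.
  by case: (mean_rate_spec reg (pos j, pos j)).
have b2 : `|N%:R^-1 * (g (pos j) * tr (pos j, pos j))| <= N%:R^-1 * (B * K).
  by apply: scaled => //; apply: product => //; case: (total_rate_spec reg (pos j, pos j)).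
have b3 : `|g (pos j) * (S2 - I2)| <= B * e by rewrite normrM ler_pM.
set D1 := N%:R^-1 * (mr _ * _); set D2 := N%:R^-1 * (_ * tr _).
rewrite (_ : _ - _ = (S1 - I1) - g (pos j) * (S2 - I2) - D1 + D2); last by ring.
have := ler_normD ((S1 - I1) - g (pos j) * (S2 - I2) - D1) D2.
have := ler_normB ((S1 - I1) - g (pos j) * (S2 - I2)) D1.
have := ler_normB (S1 - I1) (g (pos j) * (S2 - I2)).
move: b1 b2; rewrite -/D1 -/D2; lra.
Qed.

End Grid.

(** The Riemann sums converge uniformly in the grid point, because that point enters
    as a parameter in the unit interval. *)
Lemma adjoint_consistent (g : R -> R) (e : R) : CT g -> 0 < e ->
  exists n0 : nat, forall N, (n0 <= N)%N -> (0 < N)%N -> forall j : 'I_N,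
    `|adjoint (fun i : 'I_N => g (pos i)) j - P2 lambda psi g (pos j)| <= e.
Proof.
move=> gCT e0; have [B gB] := CT_bounded gCT; have [cg _] := gCT.
have B0 : 0 <= B by exact: le_trans (gB 0).
have B1 : 0 < 1 + B by rewrite ltr_pwDl.
pose e' := e / 2 / (1 + B); have e'0 : 0 < e' by rewrite !divr_gt0.
have [n1 h1] := riemann_uniform (transport_continuous reg cg) e'0.
have [n2 h2] := riemann_uniform (total_rate_continuous reg) e'0.
pose n3 := Num.bound (2 * (B * K) * (e / 2)^-1).
exists (maxn n1 (maxn n2 n3)) => N; rewrite !geq_max => /and3P[N1 N2 N3] N0 j.
have q1 := h1 N N1 N0 (pos j) (urn_pos_itv j).
have q2 := h2 N N2 N0 (pos j) (urn_pos_itv j).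
apply: le_trans (adjoint_P2_dist gB (ltW e'0) q1 q2) _.
have -> : (1 + B) * e' = e / 2 by rewrite /e' mulrC divfK// gt_eqF.
suff : 2 * (B * K) * N%:R^-1 <= e / 2 by lra.
have e2 : 0 < e / 2 by rewrite divr_gt0.
rewrite ler_pdivrMr ?ltr0n// -ler_pdivrMl// mulrC ltW//.
apply: lt_le_trans (archi_boundP _) _; first by rewrite mulr_ge0 ?mulr_ge0// invr_ge0 ltW.
by rewrite ler_nat.
Qed.

Variable phi : R -> R.
Hypothesis phiCT : CT phi.

(** The error of one more step is the previous error, amplified by the uniformly
    bounded matrix, plus a consistency error for a fixed continuous function. *)
Lemma adjoint_iter_consistent n (e : R) : 0 < e ->
  exists n0 : nat, forall N, (n0 <= N)%N -> (0 < N)%N -> forall j : 'I_N,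
    `|iter n (@adjoint N) (fun i => phi (pos i)) j
      - P2_iter lambda psi phi n (pos j)| <= e.
Proof.
elim: n e => [|n IH] e e0.
  by exists 0%N => N _ _ j; rewrite subrr normr0 ltW.
have e2 : 0 < e / 2 by rewrite divr_gt0.
have K5 : 0 < 1 + 5 * K by rewrite ltr_pwDl// mulr_ge0.
have [n1 h1] := adjoint_consistent (P2_iter_CT reg phiCT n) e2.
have [n2 h2] := IH (e / 2 / (1 + 5 * K)) ltac:(by rewrite divr_gt0).
exists (maxn n1 n2) => N; rewrite geq_max => /andP[N1 N2] N0 j.
have q1 := h1 N N1 N0 j; have q2 := adjoint_bound N0 (h2 N N2 N0) j.
rewrite -adjointB in q2.
rewrite iterS (_ : P2_iter lambda psi phi n.+1 (pos j) =
  P2 lambda psi (P2_iter lambda psi phi n) (pos j))//.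
set a := adjoint _ j in q2 *; set b := adjoint _ j in q1 q2.
have q3 : e / 2 / (1 + 5 * K) * (5 * K) <= e / 2.
  rewrite mulrAC ler_pdivrMr// ler_wpM2l ?(ltW e2)//; lra.
rewrite (_ : a - _ = (a - b) + (b - P2 lambda psi (P2_iter lambda psi phi n) (pos j))); last by ring.
rewrite (le_trans (ler_normD _ _))//; lra.
Qed.

Variable f : R -> R.
Hypothesis fCT : CT f.

(** The coefficient of [t ^+ n / n`!] in the mean of the empirical measure. *)
Definition discrete_coef (N n : nat) : R :=
  N%:R^-1 * \sum_(i < N) phi (pos i) *
    iter n (@drift_app R lambda psi N) (fun i : 'I_N => f (pos i)) i.

Lemma discrete_coef_cvg n :
  discrete_coef N n @[N --> \oo] -->
  torus_int (fun u => P2_iter lambda psi phi n u * f u).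
Proof.
have [A fA] := CT_bounded fCT; have [cf _] := fCT.
have A0 : 0 <= A by exact: le_trans (fA 0).
have A1 : 0 < 1 + A by rewrite ltr_pwDl.
have [cP _] := P2_iter_CT reg phiCT n.
apply/cvgrPdist_le => e e0.
have e2 : 0 < e / 2 by rewrite divr_gt0.
have eA : 0 < e / 2 / (1 + A) by rewrite divr_gt0.
have [n1 h1] := adjoint_iter_consistent n eA.
pose H (z : R * R) := P2_iter lambda psi phi n z.2 * f z.2.
have cH : continuous H.
  move=> [a b]; have hs : x.2 @[x --> ((a, b) : R * R)] --> b by exact: cvg_snd.
  by apply: cvgM; [exact: (cvg_comp _ _ hs (cP b))|exact: (cvg_comp _ _ hs (cf b))].
have [n2 h2] := riemann_uniform cH e2.
near=> N.
have N0 : (0 < N)%N by near: N; exists 1%N.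
have N1 : (n1 <= N)%N by near: N; exists n1.
have N2 : (n2 <= N)%N by near: N; exists n2.
have q2 := h2 N N2 N0 0 ltac:(by rewrite lexx ler01).
have q1 : `|N%:R^-1 * \sum_(j < N) (iter n (@adjoint N) (fun i => phi (pos i)) j
      - P2_iter lambda psi phi n (pos j)) * f (pos j)| <= e / 2.
  apply: average_bound => [|j]; first exact: ltW.
  rewrite normrM; apply: (@le_trans _ _ (e / 2 / (1 + A) * A)).
    by apply: ler_pM => //; exact: h1.
  by rewrite mulrAC ler_pdivrMr// ler_wpM2l ?(ltW e2)//; lra.
rewrite /discrete_coef adjoint_pairing distrC.
set S := N%:R^-1 * _ in q2.
have -> : N%:R^-1 * \sum_(j < N) iter n (@adjoint N) (fun i => phi (pos i)) j * f (pos j)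
  = N%:R^-1 * \sum_(j < N) (iter n (@adjoint N) (fun i => phi (pos i)) j
      - P2_iter lambda psi phi n (pos j)) * f (pos j) + S.
  rewrite /S -mulrDr -big_split/=; congr (_ * _); apply: eq_bigr => j _.
  by rewrite /H/=; ring.
rewrite -addrA (le_trans (ler_normD _ _))//.
have : `|S - torus_int (fun u => P2_iter lambda psi phi n u * f u)| <= e / 2 by exact: q2.
lra.
Unshelve. all: by end_near. Qed.

(** Both sides are exponential series in [t]; the coefficients converge and are
    dominated uniformly in [N] by those of a fixed exponential. *)
Lemma discrete_mean_cvg t :
  N%:R^-1 * \sum_(i < N) phi (pos i) *
    flow lambda psi (fun i : 'I_N => f (pos i)) t i @[N --> \oo] -->
  torus_int (fun u => rho lambda psi phi t u * f u).
Proof.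
have [M phiM] := CT_bounded phiCT; have [A fA] := CT_bounded fCT.
have [cf _] := fCT.
have M0 : 0 <= M by exact: le_trans (phiM 0).
have A0 : 0 <= A by exact: le_trans (fA 0).
apply: (@has_sum_tannery R (fun N n => discrete_coef N n / n`!%:R * t ^+ n)
  (fun n => torus_int (fun u => P2_iter lambda psi phi n u * f u) / n`!%:R * t ^+ n)
  (fun n => M * A * (n`!%:R^-1 * (2 * K * `|t|) ^+ n)) (M * A * expR (2 * K * `|t|))).
- move=> N n; rewrite [X in X <= _]normrM [X in X * _ <= _]normrM normrX normfV normr_nat.
  rewrite (exprMn n (2 * K) `|t|) (_ : M * A * _ =
    M * (A * (2 * K) ^+ n) / n`!%:R * `|t| ^+ n); last by ring.
  rewrite ler_wpM2r ?exprn_ge0// ler_wpM2r ?invr_ge0//.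
  have C0 : 0 <= M * (A * (2 * K) ^+ n).
    by rewrite !mulr_ge0// exprn_ge0// mulr_ge0.
  apply: average_bound => // i.
  have N0 : (0 < N)%N by exact: leq_ltn_trans (leq0n i) (ltn_ord i).
  rewrite normrM; apply: ler_pM => //.
  exact: (iter_drift_bound reg N0 (f := fun i : 'I_N => f (pos i)) (fun i => fA (pos i))).
- move=> n; apply: cvgMr_tmp; apply: cvgMr_tmp; exact: discrete_coef_cvg.
- exact: has_sumZ (has_sum_expR _).
- move=> N; rewrite mulr_sumr.
  apply: (@eq_has_sum _ (fun n => \sum_(i < N) N%:R^-1 * (phi (pos i) *
    (iter n (@drift_app R lambda psi N) (fun i : 'I_N => f (pos i)) i / n`!%:R * t ^+ n)))).
    move=> n; rewrite /discrete_coef mulr_sumr !mulr_suml.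
    by apply: eq_bigr => i _; ring.
  apply: has_sum_sum => i _; do 2 apply: has_sumZ.
  have N0 : (0 < N)%N by exact: leq_ltn_trans (leq0n i) (ltn_ord i).
  exact: (egf_has_sum (fun n => iter_drift_bound reg N0 (f := fun i : 'I_N => f (pos i))
    (fun i => fA (pos i)) n i) t).
- by apply: (rho_has_sum_int reg phiCT phiM) => //; exists A.
Qed.

End Discretisation.

Section Convergence.
Variables (R : realType) (lambda : nat -> R * R -> R) (psi : nat -> R -> R).
Variable K : R.
Hypothesis reg : regular_rates lambda psi K.
Variables (phi f : R -> R) (M A t : R).
Hypotheses (phi0 : forall u, 0 <= phi u) (phiM : forall u, `|phi u| <= M).
Hypotheses (fA : forall u, `|f u| <= A) (t0 : 0 <= t).

Let G := A * expR (2 * K * t).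
Let E := expR (2 * K * (G ^+ 2 + 1) * t).

(** Dividing by [N ^+ 2] leaves the bias of the mean and fluctuations of order
    [1 / N], since the three other terms of the second moment are of order at
    most [N]. *)
Lemma empirical_L2 (N : nat) (d : measure_display) (Omega : measurableType d)
  (P : probability Omega R) (X : R -> Omega -> config N) (c : R) : (0 < N)%N ->
  urn_branching_process lambda psi P X -> independent_poisson P phi (X 0) ->
  ('N[P]_(2%:E)[(fun w => (empirical X t f w - c)%:E)] <=
   (Num.sqrt ((N%:R^-1 * \sum_(i < N) phi (urn_pos R i) *
      flow lambda psi (fun i : 'I_N => f (urn_pos R i)) t i - c) ^+ 2
    + N%:R^-1 * (M * G ^+ 2 + E * M + (1 + t))))%:E)%E.
Proof.
move=> N0 urnX poissonX.
pose fN (i : 'I_N) := f (urn_pos R i).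
pose g := flow lambda psi fN t.
have Npos : 0 < N%:R :> R by rewrite ltr0n.
have Nn0 : N%:R != 0 :> R by rewrite gt_eqF.
have M0 : 0 <= M by exact: le_trans (phiM 0).
have A0 : 0 <= A by exact: le_trans (fA 0).
have mX0 : forall x, measurable (X t @^-1` [set x]).
  by move=> x; case: urnX => mX _; exact: mX.
have key := urn_second_moment reg N0 phi0 urnX poissonX (N%:R * c)
  (fun i => fA (urn_pos R i) : `|fN i| <= A) t0.
rewrite -/g -/G -/E in key.
have b1 : \sum_(i < N) phi (urn_pos R i) * g i ^+ 2 <= N%:R * (M * G ^+ 2).
  apply: (@le_trans _ _ (\sum_(i < N) M * G ^+ 2)).
    apply: ler_sum => i _; apply: ler_pM => //; first exact: sqr_ge0.
      exact: le_trans (ler_norm _) (phiM _).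
    have gG : `|g i| <= G.
      apply: (flow_bound reg N0 (A := A)); first by move=> j; exact: fA.
      by rewrite t0 lexx.
    rewrite -[leLHS]real_normK ?num_real// ler_sqr ?nnegrE//.
    exact: le_trans gG.
  by rewrite sumr_const card_ord -[_ *+ N]mulr_natl.
have b2 : \sum_(i < N) phi (urn_pos R i) <= N%:R * M.
  apply: (@le_trans _ _ (\sum_(i < N) M)).
    by apply: ler_sum => i _; exact: le_trans (ler_norm _) (phiM _).
  by rewrite sumr_const card_ord -[_ *+ N]mulr_natl.
set m := N%:R^-1 * _.
pose V := (m - c) ^+ 2 + N%:R^-1 * (M * G ^+ 2 + E * M + (1 + t)).
have V0 : 0 <= V.
  rewrite addr_ge0 ?sqr_ge0// mulr_ge0 ?invr_ge0// !addr_ge0//.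
  - by rewrite mulr_ge0 ?sqr_ge0.
  - by rewrite mulr_ge0 ?expR_ge0.
have sq w : (empirical X t f w - c) ^+ 2 =
    (N%:R^-1) ^+ 2 * (lin fN (X t w) - N%:R * c) ^+ 2.
  rewrite -exprMn; congr (_ ^+ 2); rewrite mulrBr mulKf//.
have intV : (\int[P]_w ((empirical X t f w - c) ^+ 2)%:E <= V%:E)%E.
  under eq_integral => w _ do rewrite sq EFinM.
  have mF := measurable_fun_discrete mX0
    (fun x => (lin fN x - N%:R * c) ^+ 2).
  rewrite (ge0_integralZl_EFin P measurableT _ mF (sqr_ge0 _)); last first.
    by move=> w _; rewrite lee_fin sqr_ge0.
  apply: (@le_trans _ _ (((N%:R^-1) ^+ 2)%:E * _)%E).
    by apply: lee_wpmul2l key; rewrite lee_fin sqr_ge0.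
  rewrite -EFinM lee_fin.
  have -> : V = (N%:R^-1) ^+ 2 * ((N%:R * m - N%:R * c) ^+ 2
      + N%:R * (M * G ^+ 2) + E * (N%:R * M) + N%:R * (1 + t)).
    by rewrite /V; field.
  rewrite ler_wpM2l ?sqr_ge0// /m mulVKf// lerD//; last first.
    by rewrite ler_peMl ?addr_ge0// ler1n.
  by rewrite lerD// ?lerD// ler_wpM2l ?expR_ge0.
rewrite unlock /=.
have -> : (\int[P]_w `|(empirical X t f w - c)%:E| `^ 2 =
    \int[P]_w ((empirical X t f w - c) ^+ 2)%:E)%E.
  apply: eq_integral => w _; rewrite abse_EFin poweR_EFin powR_mulrn//.
  by rewrite real_normK ?num_real.
rewrite -powR12_sqrt// -poweR_EFin.
apply: gt0_ler_poweR => //.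
- by rewrite in_itv/= leey andbT; apply: integral_ge0 => w _; rewrite lee_fin sqr_ge0.
- by rewrite in_itv/= leey andbT lee_fin.
Qed.

End Convergence.

Theorem theorem2p1 (R : realType)
  (lambda : nat -> R * R -> R) (psi : nat -> R -> R) (eps0 : R)
  (heps0 : 0 < eps0) (hrates : branching_rates lambda psi eps0)
  (phi : R -> R) (hphi : CinfT phi) (hphi0 : forall u, 0 <= phi u)
  (d : nat -> measure_display) (Omega : forall N, measurableType (d N))
  (P : forall N, probability (Omega N) R)
  (X : forall N, R -> Omega N -> config N)
  (hX : forall N, (1 <= N)%N -> urn_branching_process lambda psi (P N) (X N))
  (hX0 : forall N, (1 <= N)%N -> independent_poisson (P N) phi (X N 0)) :
  exists rho : R -> R -> R,
    [/\ ode_solution lambda psi phi rho,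
        forall rho' : R -> R -> R, ode_solution lambda psi phi rho' ->
          forall t, 0 <= t -> rho' t = rho t &
        forall (t : R) (f : R -> R), 0 <= t -> CT f ->
          ('N[P N]_(2%:E)[(fun w => (empirical (X N) t f w
             - torus_int (fun u => (rho t u * f u)%R))%:E)])%E
            @[N --> \oo] --> 0%E].
Proof.
have [K reg] := branching_regular_rates heps0 hrates.
have phiCT : CT phi by case: hphi => [/(_ 0%N) [cphi _]] pphi; split.
have [M phiM] := CT_bounded phiCT.
exists (rho lambda psi phi); split.
- exact: (rho_ode reg phiCT).
- move=> rho' sol t t0; exact: (ode_unique reg sol (rho_ode reg phiCT) t0).
move=> t f t0 fCT; have [A fA] := CT_bounded fCT.
set c := torus_int _.
pose G := A * expR (2 * K * t).
pose C := M * G ^+ 2 + expR (2 * K * (G ^+ 2 + 1) * t) * M + (1 + t).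
pose m N := N%:R^-1 * \sum_(i < N) phi (urn_pos R i) *
  flow lambda psi (fun i : 'I_N => f (urn_pos R i)) t i.
have mc : m N @[N --> \oo] --> c by exact: (discrete_mean_cvg reg phiCT fCT).
have h : ((Num.sqrt ((m N - c) ^+ 2 + N%:R^-1 * C))%:E)%E @[N --> \oo] --> 0%E.
  apply: cvg_EFin; first by near=> N.
  have inv0 : N%:R^-1 @[N --> \oo] --> (0 : R).
    rewrite -cvg_shiftS; exact: cvg_harmonic.
  have : (m N - c) ^+ 2 + N%:R^-1 * C @[N --> \oo] --> (0 : R).
    rewrite -[X in _ --> X](_ : (c - c) ^+ 2 + 0 * C = 0); last first.
      by rewrite subrr expr0n mul0r addr0.
    apply: cvgD; last by apply: cvgMr_tmp.
    have mc0 : m N - c @[N --> \oo] --> c - c by apply: cvgB => //; exact: cvg_cst.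
    exact: (cvgM mc0 mc0).
  move=> /(continuous_cvg _ (@sqrt_continuous R _)); rewrite sqrtr0; exact.
apply: (squeeze_cvge _ (cvg_cst 0%E) h); near=> N.
have N0 : (0 < N)%N by near: N; exists 1%N.
rewrite Lnorm_ge0/=.
exact: (empirical_L2 reg hphi0 phiM fA t0 c N0 (hX N N0) (hX0 N N0)).
Unshelve. all: by end_near. Qed.
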